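(* There exists a constant $C>0$, independent of the mesh-size, such that for every $\mathcal{T}\in\mathbb{T}$ the solution $(p,\alpha)\in X\times Y$ of the continuous problem and the discrete solution $(p_h,\alpha_h)\in X_h(\mathcal{T})\times Y_h(\mathcal{T})$ of the discrete problem satisfy $$\|p-p_h\|_{L^2(\Omega)}+\|\operatorname{Curl}(\alpha-\alpha_h)\|_{L^2(\Omega)}\le C\Big(\min_{q_h\in X_h(\mathcal{T})}\|p-q_h\|_{L^2(\Omega)}+\min_{\beta_h\in Y_h(\mathcal{T})}\|\operatorname{Curl}(\alpha-\beta_h)\|_{L^2(\Omega)}\Big).$$
   Context: $\Omega\subseteq\mathbb{R}^2$ is a simply connected, bounded, polygonal Lipschitz domain. $L^2_0(\Omega)$ is the set of $L^2(\Omega)$ functions with vanishing integral mean. For scalar $\beta$, $\operatorname{Curl}\beta:=(\partial\beta/\partial x_2,-\partial\beta/\partial x_1)$. Set $X:=L^2(\Omega;\mathbb{R}^2)$ and $Y:=H^1(\Omega)\cap L^2_0(\Omega)$. Let $f\in L^2(\Omega)$ and let $\varphi\in H(\operatorname{div},\Omega)$ ($L^2$ fields with weak divergence in $L^2$) satisfy $-\operatorname{div}\varphi=f$. Continuous problem: $(p,\alpha)\in X\times Y$ is the (unique) pair with $(p,q)_{L^2(\Omega)}+(q,\operatorname{Curl}\alpha)_{L^2(\Omega)}=(\varphi,q)_{L^2(\Omega)}$ for all $q\in X$ and $(p,\operatorname{Curl}\beta)_{L^2(\Omega)}=0$ for all $\beta\in Y$. A regular triangulation $\mathcal{T}$ of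 $\Omega$ is a finite set of closed triangles with $\overline\Omega=\bigcup\mathcal{T}$ such that any two distinct triangles are either disjoint or share exactly one common edge or one vertex. $\mathcal{T}_0$ is an arbitrary fixed initial regular triangulation of $\Omega$, each triangle being equipped with a refinement edge; $\mathbb{T}$ is the set of admissible triangulations, i.e. regular triangulations that can be created from $\mathcal{T}_0$ by newest-vertex bisection (in particular $\mathcal{T}_0\in\mathbb{T}$). By convention, constants called independent of the mesh-size depend neither on the mesh-size nor on the level of the triangulation, but may depend on $\mathcal{T}_0$ and its interior angles. For fixed $k\in\mathbb{N}\cup\{0\}$, $P_k(\mathcal{T})$ (resp. $P_k(\mathcal{T};\mathbb{R}^2)$) is the space of functions (resp. vector fields) which are, on each $T\in\mathcal{T}$, (componentwise) polynomials of total degree $\le k$. Set $X_h(\mathcal{T}):=P_k(\mathcal{T};\mathbb{R}^2)$ and $Y_h(\mathcal{T}):=P_{k+1}(\mathcal{T})\cap Y$. Discrete problem: $(p_h,\alpha_h)\in X_h(\mathcal{T})\times Y_h(\mathcal{T})$ is the (unique) pair with $(p_h,q_h)_{L^2(\Omega)}+(q_h,\operatorname{Curl}\alpha_h)_{L^2(\Omega)}=(\varphi,q_h)_{L^2(\Omega)}$ for all $q_h\in X_h(\mathcal{T})$ and $(p_h,\operatorname{Curl}\beta_h)_{L^2(\Omega)}=0$ for all $\beta_h\in Y_h(\mathcal{T})$. *)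

(* Defs.v *)
From HB Require Import structures.
From mathcomp Require Export all_boot all_order all_algebra.
From mathcomp Require Export all_classical all_reals all_analysis.
Export Order.TTheory GRing.Theory Num.Theory.
Export numFieldNormedType.Exports.

Set Implicit Arguments.
Unset Strict Implicit.
Unset Printing Implicit Defensive.

Local Open Scope classical_set_scope.
Local Open Scope ring_scope.

Definition scalar_field (R : realType) := R * R -> R.
Definition vector_field (R : realType) := R * R -> R * R.

Definition e1 (R : realType) : R * R := (1, 0).
Definition e2 (R : realType) : R * R := (0, 1).
Arguments e1 {R}.
Arguments e2 {R}.

Definition segment (R : realType) (a b : R * R) : set (R * R) :=
  [set x | exists2 t : R, 0 <= t <= 1 & x = (1 - t) *: a + t *: b].

(** * The domain *)

(* In the rotated frame ((c, s), (- s, c)) centred at the boundary point x,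
   the domain is locally the strict epigraph of a Lipschitz function. *)
Definition lipschitz_boundary (R : realType) (Omega : set (R * R)) : Prop :=
  forall x : R * R, (closure Omega `\` Omega) x ->
  exists (c s r h L : R) (g : R -> R),
    [/\ c ^+ 2 + s ^+ 2 = 1, 0 < r, 0 < h,
        {in `]- r, r[ &, forall y z, `|g y - g z| <= L * `|y - z|} &
        forall y1 y2 : R, `|y1| < r -> `|y2| < h ->
          Omega (x + y1 *: (c, s) + y2 *: (- s, c)) <-> g y1 < y2].

Definition polygonal_boundary (R : realType) (Omega : set (R * R)) : Prop :=
  exists S : seq ((R * R) * (R * R)),
    closure Omega `\` Omega = \bigcup_(ab in [set` S]) segment ab.1 ab.2.

Definition polygonal_lipschitz_domain (R : realType) (Omega : set (R * R))
    : Prop :=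
  [/\ open Omega /\ Omega !=set0, connected Omega, bounded_set Omega,
      polygonal_boundary Omega & lipschitz_boundary Omega].

(* Connectedness is part of the notion; every loop in the set is contracted to
   a point by a homotopy of loops in the set. *)
Definition simply_connected (R : realType) (Omega : set (R * R)) : Prop :=
  connected Omega /\
  forall gamma : R -> R * R,
    {within `[0, 1], continuous gamma} ->
    (forall t, t \in `[0, 1] -> Omega (gamma t)) ->
    gamma 0 = gamma 1 ->
    exists (H : R * R -> R * R) (z : R * R),
      [/\ {within `[0, 1] `*` `[0, 1], continuous H},
          forall s t, s \in `[0, 1] -> t \in `[0, 1] -> Omega (H (s, t)),
          forall t, t \in `[0, 1] -> H (0, t) = gamma t,
          forall t, t \in `[0, 1] -> H (1, t) = z &
          forall s, s \in `[0, 1] -> H (s, 0) = H (s, 1)].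

(** * Lebesgue and Sobolev spaces *)

(* Elements of L^2 are represented by functions on the plane, of which only the
   values on Omega (up to null sets) matter. *)

Definition leb2 (R : realType)
    : {measure set (measurableTypeR R * measurableTypeR R) -> \bar R} :=
  (@lebesgue_measure R \x @lebesgue_measure R)%E.
Arguments leb2 {R}.

Definition L2 (R : realType) (Omega : set (R * R)) : set (scalar_field R) :=
  [set f | f \_ Omega \in Lfun leb2 2%:E].

Definition L2v (R : realType) (Omega : set (R * R)) : set (vector_field R) :=
  [set q | L2 Omega (fst \o q) /\ L2 Omega (snd \o q)].

Definition dotv (R : realType) (u v : R * R) : R := u.1 * v.1 + u.2 * v.2.

Definition innerv (R : realType) (Omega : set (R * R)) (p q : vector_field R)
    : R :=
  \int[leb2]_(x in Omega) dotv (p x) (q x).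

Definition normv (R : realType) (Omega : set (R * R)) (q : vector_field R) : R :=
  Num.sqrt (innerv Omega q q).

Fixpoint Cn (R : realType) (n : nat) (f : scalar_field R) : Prop :=
  continuous f /\
  if n is m.+1 then
    (forall x v, v = e1 \/ v = e2 -> derivable f x v) /\
    Cn m ('D_e1 f) /\ Cn m ('D_e2 f)
  else True.

Definition test_function (R : realType) (Omega : set (R * R))
    (psi : scalar_field R) : Prop :=
  let supp := closure [set x | psi x != 0] in
  [/\ forall n, Cn n psi, compact supp & supp `<=` Omega].

Definition is_weak_deriv (R : realType) (Omega : set (R * R)) (v : R * R)
    (u g : scalar_field R) : Prop :=
  forall psi, test_function Omega psi ->
    \int[leb2]_(x in Omega) (u x * 'D_v psi x) =
    - \int[leb2]_(x in Omega) (g x * psi x).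

Definition is_weak_div (R : realType) (Omega : set (R * R))
    (phi : vector_field R) (g : scalar_field R) : Prop :=
  forall psi, test_function Omega psi ->
    \int[leb2]_(x in Omega) dotv (phi x) ('D_e1 psi x, 'D_e2 psi x) =
    - \int[leb2]_(x in Omega) (g x * psi x).

Definition weak_derivs (R : realType) (Omega : set (R * R)) (v : R * R)
    (u : scalar_field R) : set (scalar_field R) :=
  [set g | L2 Omega g /\ is_weak_deriv Omega v u g].

Definition H1 (R : realType) (Omega : set (R * R)) : set (scalar_field R) :=
  [set u | [/\ L2 Omega u, weak_derivs Omega e1 u !=set0 &
               weak_derivs Omega e2 u !=set0]].

Definition Hdiv (R : realType) (Omega : set (R * R)) : set (vector_field R) :=
  [set phi | L2v Omega phi /\ exists2 g, L2 Omega g & is_weak_div Omega phi g].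

(* A chosen representative of the weak derivative, which is unique up to null
   sets; it is meaningful only where weak_derivs is nonempty. *)
Definition weak_deriv (R : realType) (Omega : set (R * R)) (v : R * R)
    (u : scalar_field R) : scalar_field R :=
  xget (cst 0) (weak_derivs Omega v u).

Definition Curl (R : realType) (Omega : set (R * R)) (u : scalar_field R)
    : vector_field R :=
  fun x => (weak_deriv Omega e2 u x, - weak_deriv Omega e1 u x).

Definition Xspace (R : realType) (Omega : set (R * R)) : set (vector_field R) :=
  L2v Omega.

Definition Yspace (R : realType) (Omega : set (R * R)) : set (scalar_field R) :=
  [set u | H1 Omega u /\ \int[leb2]_(x in Omega) u x = 0].

(** * Triangulations and newest-vertex bisection *)

(* The refinement edge is [base1, base2], opposite to the vertex apex. *)
Record marked_triangle (R : realType) := MarkedTriangle {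
  apex : R * R; base1 : R * R; base2 : R * R }.

Definition vertices (R : realType) (t : marked_triangle R) : set (R * R) :=
  [set apex t] `|` [set base1 t] `|` [set base2 t].

Definition carrier (R : realType) (t : marked_triangle R) : set (R * R) :=
  [set x | exists a b c : R, [/\ 0 <= a, 0 <= b, 0 <= c, a + b + c = 1 &
             x = a *: apex t + b *: base1 t + c *: base2 t]].

Definition nondegenerate (R : realType) (t : marked_triangle R) : Prop :=
  ((base1 t).1 - (apex t).1) * ((base2 t).2 - (apex t).2) -
  ((base1 t).2 - (apex t).2) * ((base2 t).1 - (apex t).1) != 0.

(* Two different markings of one and the same triangle have a two-dimensional
   intersection, so they cannot both belong to a regular triangulation. *)
Definition regular_triangulation (R : realType) (Omega : set (R * R))
    (TT : set (marked_triangle R)) : Prop :=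
  [/\ finite_set TT,
      forall t, TT t -> nondegenerate t,
      closure Omega = \bigcup_(t in TT) carrier t &
      forall t t', TT t -> TT t' -> t <> t' ->
        [\/ carrier t `&` carrier t' = set0,
            exists2 z, (vertices t `&` vertices t') z &
              carrier t `&` carrier t' = [set z] |
            exists z z', [/\ (vertices t `&` vertices t') z,
              (vertices t `&` vertices t') z', z <> z' &
              carrier t `&` carrier t' = segment z z']]].

Definition midpoint (R : realType) (a b : R * R) : R * R := 2^-1 *: (a + b).

(* The new vertex is the midpoint of the refinement edge; the refinement edge
   of either child is the edge opposite to the new vertex. *)
Definition child1 (R : realType) (t : marked_triangle R) : marked_triangle R :=
  MarkedTriangle (midpoint (base1 t) (base2 t)) (apex t) (base1 t).
Definition child2 (R : realType) (t : marked_triangle R) : marked_triangle R :=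
  MarkedTriangle (midpoint (base1 t) (base2 t)) (apex t) (base2 t).

(* Intermediate triangulations may have hanging nodes. *)
Inductive bisections (R : realType) (T0 : set (marked_triangle R))
    : set (marked_triangle R) -> Prop :=
| bisections_init : bisections T0 T0
| bisections_step TT t : bisections T0 TT -> TT t ->
    bisections T0 ((TT `\ t) `|` [set child1 t; child2 t]).

Definition admissible (R : realType) (Omega : set (R * R))
    (T0 : set (marked_triangle R)) : set (set (marked_triangle R)) :=
  [set TT | bisections T0 TT /\ regular_triangulation Omega TT].

(** * Discrete spaces *)

(* The polynomial of total degree at most k with coefficients c i j. *)
Definition poly2 (R : realType) (k : nat) (c : nat -> nat -> R)
    : scalar_field R :=
  fun x => \sum_(i < k.+1) \sum_(j < (k - i).+1) c i j * x.1 ^+ i * x.2 ^+ j.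

(* Piecewise polynomials are elements of L^2: they are polynomial almost
   everywhere on each closed triangle, so that jumps across edges are allowed. *)
Definition Pk (R : realType) (Omega : set (R * R)) (k : nat)
    (TT : set (marked_triangle R)) : set (scalar_field R) :=
  [set f | L2 Omega f /\ forall t, TT t -> exists c : nat -> nat -> R,
     {ae leb2, forall x, carrier t x -> f x = poly2 k c x}].

Definition Xh (R : realType) (Omega : set (R * R)) (k : nat)
    (TT : set (marked_triangle R)) : set (vector_field R) :=
  [set q | Pk Omega k TT (fst \o q) /\ Pk Omega k TT (snd \o q)].

Definition Yh (R : realType) (Omega : set (R * R)) (k : nat)
    (TT : set (marked_triangle R)) : set (scalar_field R) :=
  Pk Omega k.+1 TT `&` Yspace Omega.

Definition mixed_solution (R : realType) (Omega : set (R * R))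
    (V : set (vector_field R)) (W : set (scalar_field R))
    (phi p : vector_field R) (alpha : scalar_field R) : Prop :=
  [/\ V p, W alpha,
      forall q, V q ->
        innerv Omega p q + innerv Omega q (Curl Omega alpha) =
        innerv Omega phi q &
      forall beta, W beta -> innerv Omega p (Curl Omega beta) = 0].

Definition is_min (R : realType) (A : set R) (m : R) : Prop :=
  A m /\ lbound A m.

(* Main.v *)
From HB Require Import structures.
Require Import Defs.
From mathcomp Require Import measurable_realfun lra.

(** The discrete problem is a conforming Galerkin method, because the Curl of a
    discrete function is again discrete: [Curl_Yh_Xh].  Everything else takes
    place in the semi-inner product space of L2 vector fields and gives the
    constant C = 2, whatever the triangulation.

    Put e := Curl alpha - Curl alphah.  For discrete fields w, subtracting the
    first equations of the two problems gives (p - ph, w) + (w, e) = 0.  For w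
    = Curl beta with beta in Yh, both p and ph are orthogonal to w, so e is
    orthogonal to Curl Yh.  Hence alphah itself minimizes |Curl (alpha - beta)|
    and the second minimum m2 equals |e|.  Let q be the orthogonal projection
    of p onto Xh, so that the first minimum is m1 = |p - q|.  With d := q - ph
    in Xh one gets |d|^2 = (p - ph, d) = - (d, e), so |d| <= |e|, and by the
    triangle inequality |p - ph| <= m1 + m2.  Adding |e| = m2 gives the bound
    m1 + 2 m2 ([quasi_optimal], [orthogonal_minimal], [best_approximation]).

    Three analytic facts carry this argument.

    - Weak derivatives are unique almost everywhere, so that the chosen
      representatives behave linearly ([weak_derivs_unique], [Curl_lin]).  This
      is the fundamental lemma of the calculus of variations: smooth bumps
      built from exp (- 1 / x) converge to indicators of boxes
      ([test_function_box_bump], [ae_box_bump_cvg1]), so an L2 function that is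
      orthogonal to all bumps in an open set has zero integral over every box
      inside it, and boxes generate the Borel sets ([box_bump_integral0_ae0]).

    - Where an H1 function agrees almost everywhere with a C1 function, its weak
      derivatives are the classical ones ([weak_deriv_classical]), by
      integration by parts on boxes.  On a triangle a piecewise polynomial of
      degree k + 1 therefore has weak derivatives of degree k; the edges of the
      triangle and the boundary of the domain are finite unions of segments,
      hence null sets ([weak_deriv_Pk]).

    - Up to null sets, piecewise polynomials are spanned by finitely many
      truncated monomials, one family for each triangle ([Pk_in_span]), so the
      projection onto Xh exists ([Pk_projection], [Xh_projection]). *)

Set Implicit Arguments.
Unset Strict Implicit.
Unset Printing Implicit Defensive.

Local Open Scope classical_set_scope.
Local Open Scope ring_scope.

(** * Boxes and open sets in the plane *)

(** The plane with its Borel sigma-algebra.  The carrier is convertible to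
    R * R, which bears the topology. *)
Notation plane R := (measurableTypeR R * measurableTypeR R)%type.

Definition cbox (R : realType) (a b c d : R) : set (plane R) :=
  `[a, b] `*` `[c, d].

Lemma measurable_cbox (R : realType) (a b c d : R) : measurable (cbox a b c d).
Proof. by apply: measurableX; exact: measurable_itv. Qed.

(** Rational corners are what makes the cover of an open set by such boxes
    countable. *)
Lemma rational_box (R : realType) (U : set (R * R)) (x : R * R) : open U -> U x ->
  exists q : (rat * rat) * (rat * rat),
    [/\ ratr q.1.1 < x.1 < ratr q.1.2, ratr q.2.1 < x.2 < ratr q.2.2 &
        cbox (ratr q.1.1) (ratr q.1.2) (ratr q.2.1) (ratr q.2.2) `<=` U].
Proof.
move=> oU Ux; have /nbhs_ballP[e /= e0 eU] : nbhs x U by exact: open_nbhs_nbhs.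
have aux (y : R) : exists p : rat * rat, [/\ ratr p.1 < y < ratr p.2,
    y - e < ratr p.1 & ratr p.2 < y + e].
  have /rat_in_itvoo[p] : y - e < y by rewrite ltrBlDr ltrDl.
  have /rat_in_itvoo[q] : y < y + e by rewrite ltrDl.
  rewrite !in_itv/= => /andP[q1 q2] /andP[p1 p2].
  by exists (p, q); rewrite p2 q1.
have [p [p1 p2 p3]] := aux x.1; have [q [q1 q2 q3]] := aux x.2.
exists (p, q); split => // -[y z] [] /=; rewrite !in_itv/=.
move=> /andP[y1 y2] /andP[z1 z2]; apply: eU; split; rewrite /ball/= ltr_distlC.
  by rewrite (lt_le_trans p2 y1) (le_lt_trans y2 p3).
by rewrite (lt_le_trans q2 z1) (le_lt_trans z2 q3).
Qed.

(** The boxes are indexed by all codes of rational quadruples; a code that gives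
    no box inside U contributes the empty set. *)
Lemma open_bigcup_cbox (R : realType) (U : set (R * R)) : open U ->
  exists B : nat -> set (R * R), U = \bigcup_n B n /\
    forall n, B n = set0 \/ exists a b c d : R,
      [/\ a < b, c < d & B n = cbox a b c d].
Proof.
move=> oU.
pose T : Type := ((rat * rat) * (rat * rat))%type.
pose bx (q : T) : set (R * R) :=
  cbox (ratr q.1.1) (ratr q.1.2) (ratr q.2.1) (ratr q.2.2).
pose good (q : T) := [/\ q.1.1 < q.1.2, q.2.1 < q.2.2 & bx q `<=` U].
pose B n : set (R * R) := if @unpickle T n is Some q then
   (if `[< good q >] then bx q else set0) else set0.
exists B; split.
  apply/seteqP; split => [x Ux|x [n _]]; last first.
    rewrite /B; case: unpickle => [q|//].
    by case: asboolP => [[_ _]|]; [apply|].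
  have [q [q1 q2 qU]] := rational_box oU Ux.
  case/andP: q1 => q1 q1'; case/andP: q2 => q2 q2'.
  have gq : good q.
    by split; [rewrite -(ltr_rat R) (lt_trans q1)|
               rewrite -(ltr_rat R) (lt_trans q2)|].
  have Bq : B (pickle q) = bx q by rewrite /B pickleK asboolT.
  exists (pickle q); first exact: I.
  by rewrite Bq; split; rewrite /= in_itv/= !ltW.
move=> n; rewrite /B; case: unpickle => [q|]; last by left.
case: asboolP => [[q1 q2 _]|]; last by left.
by right; exists (ratr q.1.1), (ratr q.1.2), (ratr q.2.1), (ratr q.2.2);
   rewrite !ltr_rat.
Qed.

Lemma open_measurable_plane (R : realType) (U : set (R * R)) : open U ->
  measurable (U : set (plane R)).
Proof.
move=> /open_bigcup_cbox[B [-> HB]]; apply: bigcup_measurable => n _.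
have [->|[a [b [c [d [_ _ ->]]]]]] := HB n; [exact: measurable0|].
exact: measurable_cbox.
Qed.

Lemma closed_measurable_plane (R : realType) (A : set (R * R)) : closed A ->
  measurable (A : set (plane R)).
Proof.
by move=> /closed_openC/open_measurable_plane/measurableC; rewrite setCK.
Qed.

Lemma continuous_measurable_plane (R : realType) (f : R * R -> R) :
  continuous f -> measurable_fun setT (f : plane R -> R).
Proof.
move=> /continuousP cf.
apply: (measurability (@RGenOpens.G R)).
  exact: RGenOpens.measurableE.
move=> _ [_ [x [y ->]] <-]; rewrite setTI.
by apply: open_measurable_plane; apply: cf; exact: itv_open.
Qed.

Definition cboxes (R : realType) : set (set (plane R)) :=
  [set A | exists a b c d, A = cbox a b c d].

(** Boxes generate all open sets as countable unions; hence the two coordinate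
    projections are measurable for the sigma-algebra generated by boxes, and so
    are the measurable rectangles. *)
Lemma measurable_plane_cboxes (R : realType) :
  (measurable : set (set (plane R))) = <<s @cboxes R >>.
Proof.
apply/seteqP; split; last first.
  apply: smallest_sub; first exact: sigma_algebra_measurable.
  by move=> _ [a [b [c [d ->]]]]; exact: measurable_cbox.
have openS (U : set (R * R)) : open U ->
    measurable (U : set (g_sigma_algebraType (@cboxes R))).
  move=> /open_bigcup_cbox[B [-> HB]]; apply: bigcup_measurable => n _.
  have [->|[a [b [c [d [_ _ ->]]]]]] := HB n; [exact: measurable0|].
  by apply: sub_sigma_algebra; exists a, b, c, d.
rewrite measurable_prod_measurableType.
apply: smallest_sub; first exact: smallest_sigma_algebra.
have key (p : R * R -> R) : continuous p ->
    measurable_fun setT (p : g_sigma_algebraType (@cboxes R) -> measurableTypeR R).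
  move=> /continuousP cp; apply: (measurability (@RGenOpens.G R)).
    exact: RGenOpens.measurableE.
  move=> _ [_ [x [y ->]] <-]; rewrite setTI.
  by apply: openS; apply: cp; exact: itv_open.
move=> _ [A mA [B mB <-]].
have -> : A `*` B = (setT `&` fst @^-1` A) `&` (setT `&` snd @^-1` B).
  by apply/seteqP; split => [x []|x [[_ ?] [_ ?]]].
apply: (@measurableI _ (g_sigma_algebraType (@cboxes R))).
  by apply: key => // x; exact: cvg_fst.
by apply: key => // x; exact: cvg_snd.
Qed.

Lemma cboxes_setI (R : realType) : setI_closed (@cboxes R).
Proof.
move=> _ _ [a [b [c [d ->]]]] [a' [b' [c' [d' ->]]]].
exists (Num.max a a'), (Num.min b b'), (Num.max c c'), (Num.min d d').
apply/seteqP; split => -[x y]; rewrite /cbox/= !in_itv/= !ge_max !le_min.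
  by move=> [[/andP[-> ->] /andP[-> ->]] [/andP[-> ->] /andP[-> ->]]].
by move=> [/andP[/andP[-> ->] /andP[-> ->]] /andP[/andP[-> ->] /andP[-> ->]]].
Qed.

(** * Null sets and bounded sets in the plane *)

Lemma leb2X (R : realType) (A B : set (measurableTypeR R)) :
  measurable A -> measurable B ->
  leb2 (A `*` B) = (lebesgue_measure A * lebesgue_measure B)%E.
Proof. by move=> mA mB; exact: product_measure1E. Qed.

Lemma leb2E (R : realType) (A : set (plane R)) :
  leb2 A = (\int[lebesgue_measure]_x lebesgue_measure (xsection A x))%E.
Proof. by []. Qed.

Lemma leb2_cbox (R : realType) (a b c d : R) : (leb2 (cbox a b c d) < +oo)%E.
Proof.
rewrite leb2X; do ?exact: measurable_itv.
rewrite !lebesgue_measure_itv/=.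
by do 2 case: ifP => _; rewrite ?mul0e ?mule0 -?EFinD -?EFinM ?ltry.
Qed.

(** The sections of a line that is not vertical are points; a vertical line is a
    product with a null factor. *)
Lemma leb2_line (R : realType) (a b c : R) : (a != 0) || (b != 0) ->
  leb2 [set x : plane R | a * x.1 + b * x.2 = c] = 0%E.
Proof.
move=> ab.
have [b0|b0] := eqVneq b 0.
  have a0 : a != 0 by move: ab; rewrite b0 eqxx orbF.
  have -> : [set x : plane R | a * x.1 + b * x.2 = c] = [set c / a] `*` setT.
    apply/seteqP; split => -[x y] /=; rewrite b0 mul0r addr0.
      by move=> <-; split => //; rewrite mulrC mulKf.
    by move=> [-> _]; rewrite mulrC divfK.
  by rewrite leb2X// lebesgue_measure_set1 mul0e.
rewrite leb2E integral0_eq// => x _ /=.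
rewrite (_ : xsection _ _ = [set (c - a * x) / b]) ?lebesgue_measure_set1//.
apply/seteqP; split => y; rewrite /xsection/= inE/=.
  by move=> <-; rewrite addrC addKr mulrC mulKf.
by move=> ->; rewrite [b * _]mulrCA divff// mulr1 addrC subrK.
Qed.

Lemma closed_line (R : realType) (a b c : R) :
  closed [set x : R * R | a * x.1 + b * x.2 = c].
Proof.
have cf : continuous (fun x : R * R => a * x.1 + b * x.2 : R).
  move=> x; apply: cvgD; apply: cvgMr.
    exact: cvg_fst.
  exact: cvg_snd.
by move/continuous_closedP : cf => /(_ [set y : R | y = c]); apply; exact: closed_eq.
Qed.

Lemma segment_sub_line (R : realType) (p q : R * R) : exists a b c : R,
  (a != 0) || (b != 0) /\ segment p q `<=` [set x | a * x.1 + b * x.2 = c].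
Proof.
have [pq1|pq1] := eqVneq p.1 q.1.
  exists 1, 0, p.1; rewrite oner_eq0; split => // x [t t01 ->] /=.
  by rewrite pq1 /GRing.scale/=; lra.
exists (q.2 - p.2), (p.1 - q.1), ((q.2 - p.2) * p.1 + (p.1 - q.1) * p.2).
have -> : p.1 - q.1 != 0 by rewrite subr_eq0.
rewrite orbT; split => // x [t t01 ->] /=.
by rewrite /GRing.scale/=; lra.
Qed.

Lemma negligible_segment (R : realType) (p q : R * R) :
  leb2.-negligible (segment p q).
Proof.
have [a [b [c [ab H]]]] := segment_sub_line p q.
exists [set x | a * x.1 + b * x.2 = c]; split => //.
  by apply: closed_measurable_plane; exact: closed_line.
exact: leb2_line.
Qed.

Lemma bounded_sub_cbox (R : realType) (A : set (R * R)) : bounded_set A ->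
  exists2 M : R, 0 < M & A `<=` cbox (- M) M (- M) M.
Proof.
move=> /pinfty_ex_gt0[M M0 AM]; exists M => // x Ax.
have := AM _ Ax => /=; rewrite prod_normE ge_max !ler_norml => /andP[x1 x2].
by split; rewrite /= in_itv.
Qed.

Lemma bounded_leb2_fin (R : realType) (A : set (R * R)) :
  measurable (A : set (plane R)) -> bounded_set A -> (leb2 A < +oo)%E.
Proof.
move=> mA /bounded_sub_cbox[M M0 AM].
apply: le_lt_trans (leb2_cbox (- M) M (- M) M).
by apply: le_measure; rewrite ?inE//; exact: measurable_cbox.
Qed.

Lemma cbox_bounded (R : realType) (f : R * R -> R) (a b c d : R) :
  continuous f -> exists2 M : R, 0 < M & forall x, cbox a b c d x -> `|f x| <= M.
Proof.
move=> cf.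
have cK : compact (cbox a b c d : set (R * R)).
  by apply: compact_setX; exact: segment_compact.
have /compact_bounded : compact (f @` (cbox a b c d)).
  by apply: continuous_compact => //; exact: continuous_subspaceT.
move=> /pinfty_ex_gt0[M M0 H]; exists M => // x Bx.
by apply: H; exists x.
Qed.

(** * Almost everywhere statements and the space L2 *)

(** The form in which almost everywhere statements occur in the definition of
    piecewise polynomials. *)
Definition ae_on (R : realType) (A : set (R * R)) (P : R * R -> Prop) :=
  {ae leb2, forall x : plane R, A x -> P x}.

Lemma ae_on_mono (R : realType) (A : set (R * R)) (P Q : R * R -> Prop) :
  (forall x, A x -> P x -> Q x) -> ae_on A P -> ae_on A Q.
Proof. by rewrite /ae_on => PQ; apply: filterS => x AP Ax; apply: PQ => //; exact: AP. Qed.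

Lemma ae_on_sub (R : realType) (A B : set (R * R)) (P : R * R -> Prop) :
  A `<=` B -> ae_on B P -> ae_on A P.
Proof. by rewrite /ae_on => AB; apply: filterS => x BP /AB; exact: BP. Qed.

Lemma ae_on_trans (R : realType) (A B : set (R * R)) (P : R * R -> Prop) :
  ae_on A B -> ae_on B P -> ae_on A P.
Proof.
by rewrite /ae_on => AB BP; apply: filterS2 AB BP => x + + Ax => /(_ Ax) Bx; exact.
Qed.

Lemma ae_on_and (R : realType) (A : set (R * R)) (P Q : R * R -> Prop) :
  ae_on A P -> ae_on A Q -> ae_on A (fun x => P x /\ Q x).
Proof.
by rewrite /ae_on => AP AQ; apply: filterS2 AP AQ => x p q Ax; split; [exact: p|exact: q].
Qed.

Lemma ae_on_all (R : realType) (A : set (R * R)) (P : R * R -> Prop) :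
  (forall x, A x -> P x) -> ae_on A P.
Proof. by rewrite /ae_on => AP; apply: filterE. Qed.

Lemma ae_onU (R : realType) (A B : set (R * R)) (P : R * R -> Prop) :
  ae_on A P -> ae_on B P -> ae_on (A `|` B) P.
Proof.
by rewrite /ae_on => AP BP; apply: filterS2 AP BP => x H1 H2 [/H1|/H2].
Qed.

Section L2_space.
Context (R : realType) (Omega : set (R * R)).
Hypothesis mO : measurable (Omega : set (plane R)).
Implicit Types f g h : R * R -> R.

Lemma L2_measurable f : L2 Omega f -> measurable_fun Omega (f : plane R -> R).
Proof.
rewrite /L2/= inE => /andP[/[!inE]/= mf _].
by apply/(measurable_restrictT _ mO).
Qed.

Lemma L2_mul f g : L2 Omega f -> L2 Omega g ->
  leb2.-integrable Omega (fun x => (f x * g x)%:E).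
Proof.
move=> f2 g2; have /Lfun1_integrable := Lfun2_mul_Lfun1 f2 g2.
rewrite (_ : EFin \o _ = (fun x => (f x * g x)%:E) \_ Omega).
  by move=> H; apply/integrable_mkcond.
apply/funext => x; rewrite /= !patchE; case: ifP => _ //.
by rewrite mul0r.
Qed.

(** Brings membership in L2 back to integrability, where sums and bounds are
    easy to handle. *)
Lemma L2_sqr f : measurable_fun Omega (f : plane R -> R) ->
  leb2.-integrable Omega (fun x => (f x ^+ 2)%:E) -> L2 Omega f.
Proof.
move=> mf f2; rewrite /L2/= inE; apply/andP; split; rewrite inE/=.
  by apply/(measurable_restrictT _ mO).
rewrite /finite_norm unlock /Lnorm; apply: poweR_lty.
have /integrableP[_] := f2.
apply: le_lt_trans; rewrite le_eqVlt; apply/orP; left; apply/eqP.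
rewrite [RHS]integral_mkcond/=; apply: eq_integral => x _.
rewrite !patchE; case: ifP => _ /=.
  by rewrite powR_mulrn ?normr_ge0// normrX.
by rewrite normr0 powR0.
Qed.

Lemma L2_lin (c : R) f g : L2 Omega f -> L2 Omega g ->
  L2 Omega (fun x => f x + c * g x).
Proof.
move=> f2 g2; apply: L2_sqr.
  by apply: measurable_funD; [|apply: measurable_funM => //]; exact: L2_measurable.
rewrite (_ : (fun x => _) = (fun x => (f x * f x)%:E +
   ((2 * c)%:E * (f x * g x)%:E + (c ^+ 2)%:E * (g x * g x)%:E))%E); last first.
  by apply/funext => x; rewrite -!EFinM -!EFinD; congr EFin; lra.
apply: integrableD => //; first exact: L2_mul.
by apply: integrableD => //; apply: integrableZl => //; exact: L2_mul.
Qed.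

Lemma L2_bounded f (M : R) : (leb2 Omega < +oo)%E ->
  measurable_fun Omega (f : plane R -> R) ->
  (forall x, Omega x -> `|f x| <= M) -> L2 Omega f.
Proof.
move=> fO mf fM; apply: L2_sqr => //.
apply: (@le_integrable _ _ _ leb2 Omega mO _ (cst (M ^+ 2)%:E)) => //.
- by apply/measurable_EFinP; exact: measurable_funX.
- move=> x Ox; rewrite /= lee_fin !normrX lerXn2r ?nnegrE//.
  by rewrite (le_trans (fM _ Ox))// ler_norm.
- apply/integrableP; split => //.
  by rewrite integral_cst// lte_mul_pinfty.
Qed.

Lemma L2_cst (c : R) : (leb2 Omega < +oo)%E -> L2 Omega (cst c).
Proof. by move=> fO; apply: (@L2_bounded _ `|c|). Qed.

Lemma L2_integrable f : (leb2 Omega < +oo)%E -> L2 Omega f ->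
  leb2.-integrable Omega (EFin \o f).
Proof.
move=> fO f2; have := L2_mul f2 (L2_cst 1 fO).
by under eq_fun do rewrite mulr1.
Qed.

Lemma ae_eq_Rintegral f g : measurable_fun Omega (f : plane R -> R) ->
  measurable_fun Omega (g : plane R -> R) ->
  ae_on Omega (fun x => f x = g x) ->
  \int[leb2]_(x in Omega) f x = \int[leb2]_(x in Omega) g x.
Proof.
move=> mf mg fg; congr fine; apply: ae_eq_integral => //; do ?exact/measurable_EFinP.
by apply: ae_on_mono fg => x Ox ->.
Qed.

Definition innerL2 f g : R := \int[leb2]_(x in Omega) (f x * g x).

Lemma innerL2_lin (c : R) f g h : L2 Omega f -> L2 Omega g -> L2 Omega h ->
  innerL2 (fun x => f x + c * g x) h = innerL2 f h + c * innerL2 g h.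
Proof.
move=> f2 h2 q2; rewrite /innerL2 -RintegralZl//; last exact: L2_mul.
rewrite -RintegralD//.
- by apply: eq_Rintegral => x _; rewrite mulrDl mulrA.
- exact: L2_mul.
- exact: (integrableZl mO c (L2_mul h2 q2)).
Qed.

Lemma innerL2C f g : innerL2 f g = innerL2 g f.
Proof. by apply: eq_Rintegral => x _; rewrite mulrC. Qed.

Lemma innerL2_ge0 f : 0 <= innerL2 f f.
Proof. by apply: Rintegral_ge0 => x _; rewrite -expr2 sqr_ge0. Qed.

Lemma innerv_integrable p q : L2v Omega p -> L2v Omega q ->
  leb2.-integrable Omega (fun x => (dotv (p x) (q x))%:E).
Proof.
move=> [p1 p2] [q1 q2].
by apply: (@integrableD _ _ _ leb2 _ mO (fun x => ((p x).1 * (q x).1)%:E)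
  (fun x => ((p x).2 * (q x).2)%:E)); exact: L2_mul.
Qed.

Lemma L2v_lin (c : R) p q : L2v Omega p -> L2v Omega q ->
  L2v Omega (fun x => p x + c *: q x).
Proof.
move=> [p1 p2] [q1 q2].
by split; [exact: (L2_lin c p1 q1)|exact: (L2_lin c p2 q2)].
Qed.

Lemma innervC p q : innerv Omega p q = innerv Omega q p.
Proof.
by apply: eq_Rintegral => x _; rewrite /dotv mulrC [X in _ + X]mulrC.
Qed.

Lemma innerv_linl (c : R) p q r : L2v Omega p -> L2v Omega q -> L2v Omega r ->
  innerv Omega (fun x => p x + c *: q x) r = innerv Omega p r + c * innerv Omega q r.
Proof.
move=> p2 q2 r2; rewrite /innerv -RintegralZl//; last exact: innerv_integrable.
rewrite -RintegralD//.
- by apply: eq_Rintegral => x _; rewrite /dotv/= /GRing.scale/=; lra.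
- exact: innerv_integrable.
- exact: (integrableZl mO c (innerv_integrable q2 r2)).
Qed.

Lemma innerv_ge0 p : 0 <= innerv Omega p p.
Proof. by apply: Rintegral_ge0 => x _; rewrite addr_ge0// -expr2 sqr_ge0. Qed.

Lemma ae_eq_innerv p p' q : L2v Omega p -> L2v Omega p' -> L2v Omega q ->
  ae_on Omega (fun x => p x = p' x) -> innerv Omega p q = innerv Omega p' q.
Proof.
move=> p2 p2' q2 pp'; apply: ae_eq_Rintegral.
- by have /integrableP[/measurable_EFinP] := innerv_integrable p2 q2.
- by have /integrableP[/measurable_EFinP] := innerv_integrable p2' q2.
- by apply: ae_on_mono pp' => x Ox ->.
Qed.

End L2_space.

(** * Functions whose integrals over boxes vanish *)

(** The measurable sets on which h integrates to zero are closed under complement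
    and disjoint countable union, so by Dynkin's lemma they are all measurable
    sets as soon as they contain a generating pi-system. *)
Lemma integral0_pi_system_ae0 d (T : measurableType d) (R : realType)
    (mu : {measure set T -> \bar R}) (G : set (set T)) (h : T -> \bar R) :
  measurable = <<s G >> -> setI_closed G ->
  mu.-integrable setT h -> (\int[mu]_x h x = 0)%E ->
  (forall S, G S -> (\int[mu]_(x in S) h x = 0)%E) ->
  ae_eq mu setT h (cst 0%E).
Proof.
move=> mG IG ih hT hG.
have mh : measurable_fun setT h by case/integrableP : ih.
apply: integral_ae_eq => // E _ mE; rewrite integral_cst// mul0e.
have : <<s G >> E by rewrite -mG.
apply: (dynkin_induction (P := fun S => (\int[mu]_(x in S) h x = 0)%E)) => //.
- move=> S mS S0; have := hT; rewrite -(setUv S) integral_setU//.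
  + by rewrite [X in (X + _)%E]S0 add0e.
  + exact: measurableC.
  + by rewrite setUv.
  + by apply/disj_setPS; rewrite setICr.
- move=> F mF tF F0; rewrite integral_bigcup//.
    by rewrite eseries0// => n _ _; exact: F0.
  by apply: integrableS ih => //; exact: bigcupT_measurable.
Qed.

(** Extended by zero outside the box, g integrates to zero over every box of the
    plane: the intersection with the large box is a box inside it, or a null
    set. *)
Lemma cbox_integral0_ae0 (R : realType) (a b c d : R) (g : plane R -> R) :
  a < b -> c < d -> leb2.-integrable (cbox a b c d) (EFin \o g) ->
  (forall a' b' c' d' : R, a' < b' -> c' < d' ->
    cbox a' b' c' d' `<=` cbox a b c d ->
    \int[leb2]_(x in cbox a' b' c' d') g x = 0) ->
  ae_on (cbox a b c d) (fun x => g x = 0).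
Proof.
move=> ab cd ig g0.
set Q := cbox a b c d in ig g0 *.
have mQ : measurable Q by exact: measurable_cbox.
have sub0 A : measurable A -> cboxes A -> A `<=` Q ->
    (\int[leb2]_(x in A) (g x)%:E = 0)%E.
  move=> mA [a' [b' [c' [d' A']]]] AQ.
  have iA : leb2.-integrable A (EFin \o g) by apply: integrableS ig.
  have mg : measurable_fun A (EFin \o g) by case/integrableP : iA.
  (* a box with a' >= b' is empty or lies on the line x1 = a' *)
  have [ab'|ab'] := ltP a' b'; last first.
    apply: (@null_set_integral _ _ _ leb2) => //.
    apply/eqP; rewrite -measure_le0 -(@leb2_line R 1 0 a') ?oner_eq0//.
    apply: le_measure; rewrite ?inE//.
      by apply: closed_measurable_plane; exact: closed_line.
    move=> x; rewrite A' => -[] /=; rewrite in_itv/= => /andP[x1 x2] _.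
    by rewrite mul1r mul0r addr0; apply/eqP; rewrite eq_le x1 (le_trans x2).
  have [cd'|cd'] := ltP c' d'; last first.
    apply: (@null_set_integral _ _ _ leb2) => //.
    apply/eqP; rewrite -measure_le0 -(@leb2_line R 0 1 c') ?oner_eq0 ?orbT//.
    apply: le_measure; rewrite ?inE//.
      by apply: closed_measurable_plane; exact: closed_line.
    move=> x; rewrite A' => -[] _ /=; rewrite in_itv/= => /andP[x1 x2].
    by rewrite mul1r mul0r add0r; apply/eqP; rewrite eq_le x1 (le_trans x2).
  rewrite -[LHS]fineK; last exact: (integrable_fin_num mA iA).
  by congr EFin; rewrite A'; apply: g0 => //; rewrite -A'.
have := @integral0_pi_system_ae0 _ _ R leb2 (@cboxes R) ((EFin \o g) \_ Q).
move=> /(_ (@measurable_plane_cboxes R) (@cboxes_setI R)).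
have QQ : cboxes Q by exists a, b, c, d.
case.
- by apply/(integrable_mkcond _ mQ).
- by rewrite -integral_mkcond; exact: sub0.
- move=> S GS; rewrite -integral_mkcondr; apply: sub0.
  + by apply: measurableI => //; rewrite measurable_plane_cboxes; exact: sub_gen_smallest.
  + exact: cboxes_setI.
  + exact: subIsetr.
- move=> N [mN N0 NH]; exists N; split => // x /= Hx; apply: NH => /= H.
  apply: Hx => Qx; have := H I; rewrite patchE mem_set// => /= -[].
  by [].
Qed.

Lemma open_integral0_ae0 (R : realType) (U : set (R * R)) (g : plane R -> R) :
  open U ->
  (forall a b c d : R, a < b -> c < d -> cbox a b c d `<=` U ->
     leb2.-integrable (cbox a b c d) (EFin \o g) /\
     \int[leb2]_(x in cbox a b c d) g x = 0) ->
  ae_on U (fun x => g x = 0).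
Proof.
move=> oU H; have [B [UB HB]] := open_bigcup_cbox oU.
suff: forall n, ae_on (B n) (fun x => g x = 0).
  rewrite /ae_on /almost_everywhere => HN.
  have := negligible_bigcup HN; apply: negligibleS => x /= Hx.
  apply: contrapT => nx; apply: Hx; rewrite UB => -[n _ Bn].
  by apply: contrapT => gx; apply: nx; exists n => //= /(_ Bn).
move=> n; have [->|[a [b [c [d [ab cd Bn]]]]]] := HB n.
  by rewrite /ae_on; apply: filterE.
have BU : cbox a b c d `<=` U by rewrite UB -Bn => x; exists n.
rewrite Bn; apply: cbox_integral0_ae0 => //.
  by have [] := H _ _ _ _ ab cd BU.
by move=> a' b' c' d' ab' cd' /subset_trans/(_ BU)/(H _ _ _ _ ab' cd')[].
Qed.

(** * Smooth functions of one variable *)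

(** The derivative is given as a witness, which avoids the computation of
    derivatives of abstract functions. *)
Fixpoint diffn (R : realType) (k : nat) (f : R -> R) : Prop :=
  if k is m.+1 then
    exists2 df : R -> R, (forall x : R, is_derive x 1 f (df x)) & diffn m df
  else True.

Lemma diffnW (R : realType) k (f : R -> R) : diffn k.+1 f -> diffn k f.
Proof.
elim: k f => [//|k IH] f [df Hf Hdf]; exists df => //; exact: IH.
Qed.

Lemma diffn_lin (R : realType) k (c : R) (f g : R -> R) :
  diffn k f -> diffn k g -> diffn k (fun x => f x + c * g x).
Proof.
elim: k f g => [//|k IH] f g [df Hf Hdf] [dg Hg Hdg].
exists (fun x => df x + c * dg x); last exact: IH.
by move=> x; exact: (is_deriveD (Hf x) (is_deriveZ c (Hg x))).
Qed.

Lemma diffn0 (R : realType) k : diffn k (fun _ : R => 0 : R).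
Proof. elim: k => [//|k IH]; exists (fun=> 0) => // x; exact: is_derive_cst. Qed.

Lemma diffnM (R : realType) k (f g : R -> R) :
  diffn k f -> diffn k g -> diffn k (fun x => f x * g x).
Proof.
elim: k f g => [//|k IH] f g Hf Hg.
have f' := diffnW Hf; have g' := diffnW Hg.
move: Hf Hg => [df Hf Hdf] [dg Hg Hdg].
exists (fun x => f x * dg x + 1 * (g x * df x)).
  by move=> x; rewrite mul1r; exact: (is_deriveM (Hf x) (Hg x)).
by apply: diffn_lin; exact: IH.
Qed.

Lemma diffn_affine (R : realType) k (f : R -> R) (a b : R) :
  diffn k f -> diffn k (fun x => f (a * x + b)).
Proof.
elim: k f => [//|k IH] f [df Hf Hdf].
exists (fun x => 0 + a * df (a * x + b)); last first.
  by apply: diffn_lin; [exact: diffn0|exact: IH].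
move=> x; rewrite add0r mulrC.
have H : is_derive x 1 (fun y : R => a * y + b) a.
  have := is_deriveD (is_deriveZ a (is_derive_id x 1)) (is_derive_cst b x 1).
  by move=> H; apply: (is_derive_eq H); rewrite addr0 /GRing.scale/= mulr1.
exact: (is_derive1_comp (Hf _) H).
Qed.

(** The function x^(-n) exp(-1/x), extended by zero to x <= 0.  All powers are
    needed because differentiation raises the power. *)
Definition flat (R : realType) (n : nat) (x : R) : R :=
  if 0 < x then x^-1 ^+ n * expR (- x^-1) else 0.

(** With y = 1/x this is y^(n+1) <= (n+1)! exp y, a term of the exponential
    series.  The linear bound yields both the continuity and the
    differentiability at 0 of the whole family. *)
Lemma flat_bound (R : realType) n (x : R) : `|flat n x| <= (n.+1)`!%:R * `|x|.
Proof.
rewrite /flat; case: ifP => [x0|_]; last by rewrite normr0 mulr_ge0.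
rewrite (gtr0_norm x0) ger0_norm; last first.
  by rewrite mulr_ge0 ?expR_ge0// exprn_ge0// invr_ge0 ltW.
rewrite expRN ler_pdivrMr ?expR_gt0//.
have xi : 0 <= x^-1 by rewrite invr_ge0 ltW.
apply: (@le_trans _ _ ((n.+1)`!%:R * x * (x^-1 ^+ n.+1 / (n.+1)`!%:R))).
  have F : (n.+1)`!%:R != 0 :> R by rewrite pnatr_eq0 -lt0n fact_gt0.
  by rewrite mulrC mulrA divfK// exprSr divfK// gt_eqF.
rewrite ler_pM2l; last by rewrite mulr_gt0// ltr0n fact_gt0.
apply: le_trans (expR_ge1Dxn n xi).
by rewrite lerDr.
Qed.

(** At 0 the difference quotient of the n-th function is the (n+1)-st function,
    which tends to 0. *)
Lemma flat_is_derive (R : realType) n (x : R) :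
  is_derive x 1 (flat n) (flat n.+2 x - n%:R * flat n.+1 x).
Proof.
have [x0|x0|x0] := ltgtP 0 x.
- apply: (@near_eq_is_derive _ _ _ (fun y : R => y^-1 ^+ n * expR (- y^-1))).
    near=> y; rewrite /flat ifT//; near: y; apply: open_nbhs_nbhs; split => //; exact: open_gt.
  rewrite /flat x0.
  have dV : is_derive x 1 (fun y : R => y^-1) (- x ^- 2 *: 1).
    by apply: is_deriveV; rewrite ?gt_eqF.
  have dX : is_derive x 1 (fun y : R => y^-1 ^+ n)
      ((n%:R * x^-1 ^+ n.-1) *: (- x ^- 2 *: 1)).
    rewrite (_ : (fun y : R => y^-1 ^+ n) = (fun y : R => y^-1) ^+ n).
      exact: is_deriveX.
    by apply/funext => y; rewrite exprfctE.
  have dE : is_derive x 1 (fun y : R => expR (- y^-1)) (expR (- x^-1) * (x ^- 2)).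
    have := @is_derive1_comp _ expR (fun y : R => - y^-1) x _ _ (is_derive_expR (- x^-1)) (is_deriveN dV).
    move=> H; apply: (is_derive_eq H).
    by rewrite /GRing.scale/= mulr1 opprK.
  have := is_deriveM dX dE.
  move=> H; apply: (is_derive_eq H).
  rewrite /GRing.scale/= !mulr1.
  rewrite -!exprVn; case: n {dX H} => [|n] /=.
    by rewrite !mul0r mulr0 !addr0; rewrite /GRing.exp/=; lra.
  rewrite !exprS; lra.
- apply: (@near_eq_is_derive _ _ _ (cst 0)).
    near=> y; rewrite /flat ifF//; apply/negbTE; rewrite -leNgt ltW//.
    near: y; apply: open_nbhs_nbhs; split => //; exact: open_lt.
  by rewrite /flat ltNge (ltW x0)/= mulr0 subr0; exact: is_derive_cst.
- rewrite -x0 {2 3}/flat ltxx mulr0 subr0.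
  suff H : h^-1 *: ((flat n \o shift 0) (h *: 1) - flat n 0) @[h --> 0^'] --> (0 : R).
    split; first by apply/cvg_ex; exists 0.
    exact: cvg_lim H.
  apply: (@cvg_to_0_linear _ _ (n.+2)`!%:R 1) => // h /andP[h0 _].
  have -> : h^-1 *: ((flat n \o shift 0) (h *: 1) - flat n 0) = flat n.+1 h.
    rewrite /= addr0 {2}/flat ltxx subr0 /GRing.scale/= mulr1 /flat.
    by case: ifP => _; rewrite ?mulr0// exprS mulrA.
  exact: flat_bound.
Unshelve. all: by end_near. Qed.

Lemma diffn_flat (R : realType) k n : diffn k (@flat R n).
Proof.
elim: k n => [//|k IH] n.
exists (fun x => flat n.+2 x + (- n%:R) * flat n.+1 x).
  by move=> x; rewrite mulNr; exact: flat_is_derive.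
exact: diffn_lin.
Qed.

(** * Smooth bumps with support in a box *)

(** A directional derivative along a coordinate axis is an ordinary derivative of
    the partial function; the two difference quotients coincide. *)
Lemma is_derive_e1P (R : realType) (f : R * R -> R) (x : R * R) (df : R) :
  is_derive x.1 1 (fun t : R => f (t, x.2)) df <-> is_derive x e1 f df.
Proof.
have E : (fun h : R => h^-1 *: ((f \o shift x) (h *: e1) - f x)) =
    (fun h : R => h^-1 *: (((fun t : R => f (t, x.2)) \o shift x.1) (h *: 1) - f (x.1, x.2))).
  apply/funext => h; congr (_ *: (f _ - f _)); last by case: (x).
  by apply/pair_equal_spec; split; rewrite //= scaler0 add0r.
by split=> -[]; rewrite /derivable /derive ?E => d1 d2; split; rewrite /derivable /derive ?E.
Qed.

Lemma is_derive_e2P (R : realType) (f : R * R -> R) (x : R * R) (df : R) :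
  is_derive x.2 1 (fun t : R => f (x.1, t)) df <-> is_derive x e2 f df.
Proof.
have E : (fun h : R => h^-1 *: ((f \o shift x) (h *: e2) - f x)) =
    (fun h : R => h^-1 *: (((fun t : R => f (x.1, t)) \o shift x.2) (h *: 1) - f (x.1, x.2))).
  apply/funext => h; congr (_ *: (f _ - f _)); last by case: (x).
  by apply/pair_equal_spec; split; rewrite //= scaler0 add0r.
by split=> -[]; rewrite /derivable /derive ?E => d1 d2; split; rewrite /derivable /derive ?E.
Qed.

Lemma is_derive_prod1 (R : realType) (f g df : R -> R) (x : R * R) :
  (forall t : R, is_derive t 1 f (df t)) ->
  is_derive x e1 (fun x => f x.1 * g x.2) (df x.1 * g x.2).
Proof.
move=> Hf; apply/is_derive_e1P => /=.
have H := is_deriveM (Hf x.1) (is_derive_cst (g x.2) x.1 1).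
by apply: (is_derive_eq H); rewrite scaler0 add0r mulrC.
Qed.

Lemma is_derive_prod2 (R : realType) (f g dg : R -> R) (x : R * R) :
  (forall t : R, is_derive t 1 g (dg t)) ->
  is_derive x e2 (fun x => f x.1 * g x.2) (f x.1 * dg x.2).
Proof.
move=> Hf; apply/is_derive_e2P => /=.
have H := is_deriveM (is_derive_cst (f x.1) x.2 1) (Hf x.2).
by apply: (is_derive_eq H); rewrite scaler0 addr0.
Qed.

Lemma diffn_continuous (R : realType) k (f : R -> R) : diffn k.+1 f -> continuous f.
Proof.
move=> [df Hf _] x; apply: differentiable_continuous; apply/derivable1_diffP.
by have [] := Hf x.
Qed.

Lemma continuous_prod (R : realType) (f g : R -> R) :
  continuous f -> continuous g -> continuous (fun x : R * R => f x.1 * g x.2).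
Proof.
move=> cf cg x; apply: cvgM.
  by apply: (@cvg_comp _ _ _ fst f _ (nbhs x.1)); [exact: cvg_fst|exact: cf].
by apply: (@cvg_comp _ _ _ snd g _ (nbhs x.2)); [exact: cvg_snd|exact: cg].
Qed.

(** The partial derivatives of a product f(x1) g(x2) have the same form, with one
    factor differentiated. *)
Lemma Cn_prod (R : realType) k (f g : R -> R) :
  diffn k.+1 f -> diffn k.+1 g -> Cn k (fun x => f x.1 * g x.2).
Proof.
elim: k f g => [|k IH] f g Hf Hg.
  by split=> //; exact: continuous_prod (diffn_continuous Hf) (diffn_continuous Hg).
split; first by exact: continuous_prod (diffn_continuous Hf) (diffn_continuous Hg).
have [df Hdf df'] := Hf; have [dg Hdg dg'] := Hg.
have E1 : 'D_e1 (fun x => f x.1 * g x.2) = (fun x => df x.1 * g x.2).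
  by apply/funext => x; have [_] := is_derive_prod1 g x Hdf.
have E2 : 'D_e2 (fun x => f x.1 * g x.2) = (fun x => f x.1 * dg x.2).
  by apply/funext => x; have [_] := is_derive_prod2 f x Hdg.
split; last first.
  by rewrite E1 E2; split; apply: IH => //; exact: diffnW.
move=> x v [->|->].
  by have [] := is_derive_prod1 g x Hdf.
by have [] := is_derive_prod2 f x Hdg.
Qed.

(** A product of two cut-offs, at a from the left and at b from the right; as n
    grows it becomes steeper and tends to 1 on the open interval. *)
Definition itv_bump (R : realType) (a b : R) (n : nat) (x : R) : R :=
  flat 0 (n.+1%:R * x + - (n.+1%:R * a)) * flat 0 (- n.+1%:R * x + n.+1%:R * b).

Lemma diffn_itv_bump (R : realType) (a b : R) n k : diffn k (itv_bump a b n).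
Proof. by apply: diffnM; apply: diffn_affine; exact: diffn_flat. Qed.

Lemma flat0_01 (R : realType) (x : R) : 0 <= flat 0 x <= 1.
Proof.
rewrite /flat; case: ifP => [x0|]; last by rewrite lexx ler01.
by rewrite expr0 mul1r expR_ge0/= expR_le1 oppr_le0 invr_ge0 ltW.
Qed.

Lemma flat0_cvg1 (R : realType) (x : R) : 0 < x ->
  (fun n : nat => flat 0 (n.+1%:R * x)) @ \oo --> (1 : R).
Proof.
move=> x0.
have -> : (fun n : nat => flat 0 (n.+1%:R * x)) =
          (fun n => expR (- (harmonic n * x^-1))).
  apply/funext => n; rewrite /flat mulr_gt0//= expr0 mul1r.
  by rewrite invfM.
rewrite -expR0; apply: (@cvg_comp _ _ _ _ expR _ (nbhs (0 : R))); last exact: continuous_expR.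
rewrite -oppr0; apply: cvgN; rewrite -(mul0r x^-1); apply: cvgMl.
exact: cvg_harmonic.
Qed.

Lemma itv_bump_out (R : realType) (a b : R) n x : ~~ (a < x < b) -> itv_bump a b n x = 0.
Proof.
have E1 : n.+1%:R * x + - (n.+1%:R * a) = n.+1%:R * (x - a) by rewrite mulrBr.
have E2 : - n.+1%:R * x + n.+1%:R * b = n.+1%:R * (b - x).
  by rewrite mulrBr addrC mulNr.
rewrite negb_and -!leNgt /itv_bump E1 E2 => /orP[H|H].
  by rewrite /flat pmulr_rgt0// subr_gt0 ltNge H/= mul0r.
by rewrite mulrC /flat pmulr_rgt0// subr_gt0 ltNge H/= mul0r.
Qed.

Lemma itv_bump_01 (R : realType) (a b : R) n x : 0 <= itv_bump a b n x <= 1.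
Proof.
have /andP[f0 f1] := flat0_01 (n.+1%:R * x + - (n.+1%:R * a)).
have /andP[g0 g1] := flat0_01 (- n.+1%:R * x + n.+1%:R * b).
by rewrite mulr_ge0//= mulr_ile1.
Qed.

Lemma itv_bump_cvg1 (R : realType) (a b : R) x : a < x < b ->
  (fun n : nat => itv_bump a b n x) @ \oo --> (1 : R).
Proof.
move=> /andP[ax xb].
have -> : (fun n : nat => itv_bump a b n x) =
   (fun n => flat 0 (n.+1%:R * (x - a)) * flat 0 (n.+1%:R * (b - x))).
  apply/funext => n; rewrite /itv_bump; congr (flat 0 _ * flat 0 _).
    by rewrite mulrBr.
  by rewrite mulrBr addrC mulNr.
have xa : 0 < x - a by rewrite subr_gt0.
have bx : 0 < b - x by rewrite subr_gt0.
by have := cvgM (flat0_cvg1 xa) (flat0_cvg1 bx); rewrite mulr1; exact.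
Qed.

Definition box_bump (R : realType) (a b c d : R) n (x : R * R) : R :=
  itv_bump a b n x.1 * itv_bump c d n x.2.

Lemma box_bump_out (R : realType) (a b c d : R) n x : ~ cbox a b c d x -> box_bump a b c d n x = 0.
Proof.
move=> H; rewrite /box_bump.
have [x1|/itv_bump_out ->] := boolP (a < x.1 < b); last by rewrite mul0r.
have [x2|/itv_bump_out ->] := boolP (c < x.2 < d); last by rewrite mulr0.
exfalso; apply: H; case/andP: x1 => ? ?; case/andP: x2 => ? ?.
by split; rewrite /= in_itv/= !ltW.
Qed.

Lemma closed_cbox (R : realType) (a b c d : R) : closed (cbox a b c d : set (R * R)).
Proof.
apply: compact_closed => //.
by apply: compact_setX; exact: segment_compact.
Qed.

Lemma test_function_box_bump (R : realType) (Omega : set (R * R)) (a b c d : R) n :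
  cbox a b c d `<=` Omega -> test_function Omega (box_bump a b c d n).
Proof.
move=> BO.
have S : closure [set x | box_bump a b c d n x != 0] `<=` cbox a b c d.
  have /closure_id E := @closed_cbox R a b c d; rewrite [X in _ `<=` X]E.
  apply: closure_subset => x /= /eqP H; apply: contrapT => Bx; apply: H.
  exact: box_bump_out.
split; last exact: subset_trans S BO.
  by move=> k; apply: Cn_prod; exact: diffn_itv_bump.
apply: (subclosed_compact _ _ S); first exact: closed_closure.
by apply: compact_setX; exact: segment_compact.
Qed.

(** * The fundamental lemma of the calculus of variations *)

Lemma ae_not_line (R : realType) (A : set (R * R)) (a b c : R) :
  (a != 0) || (b != 0) -> ae_on A (fun x => a * x.1 + b * x.2 <> c).
Proof.
move=> ab; exists [set x | a * x.1 + b * x.2 = c]; split.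
- by apply: closed_measurable_plane; exact: closed_line.
- exact: leb2_line.
- by move=> x /= H; apply: contrapT => K; apply: H.
Qed.

Lemma continuous_L2 (R : realType) (Omega : set (R * R)) (f : R * R -> R) :
  open Omega -> bounded_set Omega -> continuous f -> L2 Omega f.
Proof.
move=> oO bO cf; have mO := open_measurable_plane oO.
have [M _ OM] := bounded_sub_cbox bO.
have [N _ fN] := cbox_bounded (- M) M (- M) M cf.
apply: (@L2_bounded _ _ mO _ N).
- exact: bounded_leb2_fin.
- apply: measurable_funS (continuous_measurable_plane cf) => //.
- by move=> x /OM; exact: fN.
Qed.

Lemma box_bump_continuous (R : realType) (a b c d : R) n : continuous (box_bump a b c d n).
Proof.
by apply: continuous_prod; apply: (@diffn_continuous _ 0); exact: diffn_itv_bump.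
Qed.

Lemma box_bump_01 (R : realType) (a b c d : R) n x : 0 <= box_bump a b c d n x <= 1.
Proof.
have /andP[f0 f1] := itv_bump_01 a b n x.1; have /andP[g0 g1] := itv_bump_01 c d n x.2.
by rewrite mulr_ge0//= mulr_ile1.
Qed.

Lemma ae_box_bump_cvg1 (R : realType) (a b c d : R) :
  ae_on (cbox a b c d) (fun x => (fun n => box_bump a b c d n x) @ \oo --> (1 : R)).
Proof.
have H1 := @ae_not_line R (cbox a b c d) 1 0 a; have H2 := @ae_not_line R (cbox a b c d) 1 0 b.
have H3 := @ae_not_line R (cbox a b c d) 0 1 c; have H4 := @ae_not_line R (cbox a b c d) 0 1 d.
rewrite !oner_eq0 ?orbT in H1 H2 H3 H4.
have := ae_on_and (ae_on_and (H1 isT) (H2 isT)) (ae_on_and (H3 isT) (H4 isT)).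
apply: ae_on_mono => x [/=] + + {H1 H2 H3 H4} [[H1 H2] [H3 H4]]; rewrite !in_itv/= => x1 x2.
rewrite !mul1r !mul0r ?addr0 ?add0r in H1 H2 H3 H4.
have h1 : a < x.1 < b.
  case/andP: x1 => x1 x1'; rewrite !lt_neqAle x1 x1' !andbT eq_sym.
  by apply/andP; split; apply/eqP.
have h2 : c < x.2 < d.
  case/andP: x2 => x2 x2'; rewrite !lt_neqAle x2 x2' !andbT eq_sym.
  by apply/andP; split; apply/eqP.
by have := cvgM (itv_bump_cvg1 h1) (itv_bump_cvg1 h2); rewrite mulr1; exact.
Qed.

Lemma Rintegral_support (R : realType) (A B : set (R * R)) (f : R * R -> R) :
  B `<=` A -> (forall x, ~ B x -> f x = 0) ->
  \int[leb2]_(x in A) f x = \int[leb2]_(x in B) f x.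
Proof.
move=> BA f0; rewrite Rintegral_mkcond [RHS]Rintegral_mkcond.
apply: eq_Rintegral => x _; rewrite !patchE.
have [xB|xB] := boolP (x \in B); last first.
  by rewrite f0 ?if_same// => /mem_set; exact/negP.
by rewrite mem_set//; apply: BA; exact: set_mem.
Qed.

(** By dominated convergence the integral of g over a box is the limit of its
    integrals against bumps, which are all zero. *)
Lemma box_bump_integral0_ae0 (R : realType) (Omega U : set (R * R)) (g : R * R -> R) :
  open Omega -> bounded_set Omega -> open U -> U `<=` Omega -> L2 Omega g ->
  (forall a b c d n, a < b -> c < d -> cbox a b c d `<=` U ->
     \int[leb2]_(x in Omega) (g x * box_bump a b c d n x) = 0) ->
  ae_on U (fun x => g x = 0).
Proof.
move=> oO bO oU UO g2 H; have mO := open_measurable_plane oO.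
have ig := L2_integrable mO (bounded_leb2_fin mO bO) g2.
apply: open_integral0_ae0 => // a b c d ab cd BU.
have mB := @measurable_cbox R a b c d.
have iB : leb2.-integrable (cbox a b c d) (EFin \o g).
  by apply: integrableS ig => //; exact: subset_trans BU UO.
split=> //.
have mg : measurable_fun (cbox a b c d) (g : plane R -> R).
  by case/integrableP : iB => /measurable_EFinP.
have mfb n : measurable_fun (cbox a b c d)
    (fun x : plane R => (g x * box_bump a b c d n x)%:E).
  apply/measurable_EFinP; apply: measurable_funM => //.
  apply: measurable_funS (continuous_measurable_plane (@box_bump_continuous _ _ _ _ _ _)) => //.
have fgb n x : (`|(g x * box_bump a b c d n x)%:E| <= `|(g x)%:E|)%E.
  rewrite /= lee_fin normrM.
  have /andP[f0 f1] := box_bump_01 a b c d n x.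
  by rewrite ler_piMr// ger0_norm.
have [] := @dominated_convergence _ _ _ leb2 _ mB
  (fun n x => (g x * box_bump a b c d n x)%:E) (EFin \o g) (fun x => `|(g x)%:E|%E).
- exact: mfb.
- exact/measurable_EFinP.
- have := ae_box_bump_cvg1 a b c d; apply: ae_on_mono => x Bx Hx.
  apply/cvg_EFin; first by near=> n.
  by have := cvgM (cvg_cst (g x)) Hx; rewrite mulr1; exact.
- exact: integrable_abse.
- by apply: filterE => x n _; exact: fgb.
move=> _ _.
have -> : [sequence (\int[leb2]_(x in cbox a b c d) (g x * box_bump a b c d n x)%:E)%E]_n
    = cst 0%E.
  apply/funext => n /=.
  have := H a b c d n ab cd BU.
  rewrite (@Rintegral_support _ _ (cbox a b c d)).
  - rewrite /Rintegral => /eqP; rewrite fine_eq0 => [/eqP//|].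
    apply: (integrable_fin_num mB).
    by apply: (le_integrable mB _ _ iB) => // x _; exact: fgb.
  - exact: subset_trans BU UO.
  - by move=> x /box_bump_out ->; rewrite mulr0.
move=> /(cvg_lim (@ereal_hausdorff R)) K.
by rewrite /Rintegral -[X in fine X]K lim_cst.
Unshelve. all: by end_near. Qed.

(** * Weak derivatives and the Curl operator *)

Section weak_derivatives.
Context (R : realType) (Omega : set (R * R)).
Hypotheses (oO : open Omega) (bO : bounded_set Omega).
Let mO := open_measurable_plane oO.
Let fO := bounded_leb2_fin mO bO.
Implicit Types (u g : R * R -> R) (v : R * R).

Lemma test_function_L2 psi : test_function Omega psi -> L2 Omega psi.
Proof. by move=> [/(_ 0)[cpsi _] _ _]; exact: continuous_L2. Qed.

Lemma test_derivative_L2 psi v : v = e1 \/ v = e2 -> test_function Omega psi ->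
  L2 Omega ('D_v psi).
Proof.
move=> ve [/(_ 1)[_ [_ [[c1 _] [c2 _]]]] _ _].
by apply: continuous_L2 => //; case: ve => ->.
Qed.

Lemma weak_derivs_lin v (c : R) u u' g g' : v = e1 \/ v = e2 ->
  L2 Omega u -> L2 Omega u' ->
  weak_derivs Omega v u g -> weak_derivs Omega v u' g' ->
  weak_derivs Omega v (fun x => u x + c * u' x) (fun x => g x + c * g' x).
Proof.
move=> ve u2 u2' [g2 wg] [g2' wg']; split; first exact: L2_lin.
move=> psi tpsi.
have p2 := test_function_L2 tpsi; have d2 := test_derivative_L2 ve tpsi.
rewrite -/(innerL2 Omega (fun x => u x + c * u' x) ('D_v psi)).
rewrite -/(innerL2 Omega (fun x => g x + c * g' x) psi).
by rewrite !(innerL2_lin mO)// /innerL2 wg// wg'// mulrN opprD.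
Qed.

Lemma weak_derivs_unique v u g g' :
  weak_derivs Omega v u g -> weak_derivs Omega v u g' ->
  ae_on Omega (fun x => g x = g' x).
Proof.
move=> [g2 wg] [g2' wg'].
have : ae_on Omega (fun x => g x + (-1) * g' x = 0).
  apply: (box_bump_integral0_ae0 oO bO oO) => //; first exact: L2_lin.
  move=> a b c d n _ _ BO; have tpsi := test_function_box_bump n BO.
  have p2 := test_function_L2 tpsi.
  have := wg _ tpsi; rewrite wg'// => /eqP; rewrite eqr_opp => /eqP E.
  transitivity (\int[leb2]_(x in Omega) (g x * box_bump a b c d n x) -
                \int[leb2]_(x in Omega) (g' x * box_bump a b c d n x)).
    rewrite -RintegralB//; do ?exact: (L2_mul mO).
    by apply: eq_Rintegral => x _; rewrite mulrDl mulN1r mulNr.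
  by rewrite E subrr.
by apply: ae_on_mono => x _ /eqP; rewrite mulN1r subr_eq0 => /eqP.
Qed.

Lemma weak_derivP v u : weak_derivs Omega v u !=set0 ->
  weak_derivs Omega v u (weak_deriv Omega v u).
Proof. by move=> [g Hg]; rewrite /weak_deriv; exact: (xgetPex _ (ex_intro _ g Hg)). Qed.

Lemma H1_weak_deriv v u : v = e1 \/ v = e2 -> H1 Omega u ->
  weak_derivs Omega v u (weak_deriv Omega v u).
Proof. by move=> ve [_ H1 H2]; apply: weak_derivP; case: ve => ->. Qed.

Lemma H1_lin (c : R) u u' : H1 Omega u -> H1 Omega u' ->
  H1 Omega (fun x => u x + c * u' x).
Proof.
move=> Hu Hu'; have [u2 [g1 u1] [g2 u3]] := Hu; have [u2' [g1' u1'] [g2' u3']] := Hu'.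
split; first exact: L2_lin.
  by exists (fun x => g1 x + c * g1' x); apply: weak_derivs_lin => //; left.
by exists (fun x => g2 x + c * g2' x); apply: weak_derivs_lin => //; right.
Qed.

Lemma weak_deriv_lin v (c : R) u u' : v = e1 \/ v = e2 ->
  H1 Omega u -> H1 Omega u' ->
  ae_on Omega (fun x => weak_deriv Omega v (fun x => u x + c * u' x) x =
    weak_deriv Omega v u x + c * weak_deriv Omega v u' x).
Proof.
move=> ve Hu Hu'; have [u2 _ _] := Hu; have [u2' _ _] := Hu'.
have W := H1_weak_deriv ve (H1_lin c Hu Hu').
have W' := weak_derivs_lin c ve u2 u2' (H1_weak_deriv ve Hu) (H1_weak_deriv ve Hu').
exact: (weak_derivs_unique W W').
Qed.

Lemma Curl_L2v u : H1 Omega u -> L2v Omega (Curl Omega u).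
Proof.
move=> Hu; split; rewrite /comp /=.
  by have [] := H1_weak_deriv (or_intror erefl) Hu.
have [g2 _] := H1_weak_deriv (or_introl erefl) Hu.
have := L2_lin mO (-1) (L2_cst mO 0 fO) g2.
by congr L2; apply/funext => x /=; rewrite add0r mulN1r.
Qed.

Lemma Curl_lin (c : R) u u' : H1 Omega u -> H1 Omega u' ->
  ae_on Omega (fun x => Curl Omega (fun x => u x + c * u' x) x =
    Curl Omega u x + c *: Curl Omega u' x).
Proof.
move=> Hu Hu'.
have := ae_on_and (weak_deriv_lin c (or_introl erefl) Hu Hu')
  (weak_deriv_lin c (or_intror erefl) Hu Hu').
apply: ae_on_mono => x _ [E1 E2]; rewrite /Curl E1 E2.
by rewrite opprD -mulrN.
Qed.

End weak_derivatives.

(** * Integration by parts on a box *)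

Lemma continuous_integrable_cbox (R : realType) (f : R * R -> R) (a b c d : R) :
  continuous f -> leb2.-integrable (cbox a b c d) (EFin \o (f : plane R -> R)).
Proof.
move=> cf; have [M _ fM] := cbox_bounded a b c d cf.
have mB := @measurable_cbox R a b c d.
apply: (@le_integrable _ _ _ leb2 _ mB _ (cst M%:E)) => //.
- by apply/measurable_EFinP; apply: measurable_funS (continuous_measurable_plane cf).
- by move=> x /fM fx; rewrite /= lee_fin (le_trans fx)// ler_norm.
- apply/integrableP; split => //.
  by rewrite integral_cst// lte_mul_pinfty//; exact: leb2_cbox.
Qed.

Lemma integral_derive0 (R : realType) (F dF : R -> R) (a b : R) : a < b ->
  continuous dF -> (forall x : R, is_derive x 1 F (dF x)) -> F a = 0 -> F b = 0 ->
  (\int[lebesgue_measure]_(x in `[a, b]) (dF x)%:E = 0)%E.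
Proof.
move=> ab cdF HF Fa Fb.
have cF : continuous F.
  move=> x; apply: differentiable_continuous; apply/derivable1_diffP.
  by have [] := HF x.
rewrite (@continuous_FTC2 _ dF F)// ?Fa ?Fb ?subee//.
- exact: continuous_subspaceT.
- split; first by move=> x _; have [] := HF x.
    exact/cvg_at_right_filter/cF.
  exact/cvg_at_left_filter/cF.
- by move=> x _; rewrite derive1E; have [_] := HF x.
Qed.

(** By Fubini, it suffices to integrate along each horizontal line, where the
    fundamental theorem of calculus applies. *)
Lemma integral_partial1 (R : realType) (F dF : R * R -> R) (a b c d : R) : a < b ->
  continuous dF -> (forall x : R * R, is_derive x.1 1 (fun t : R => F (t, x.2)) (dF x)) ->
  (forall y, F (a, y) = 0) -> (forall y, F (b, y) = 0) ->
  \int[leb2]_(x in cbox a b c d) dF x = 0.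
Proof.
move=> ab cdF HF Fa Fb.
have mB := @measurable_cbox R a b c d.
have iB : leb2.-integrable setT ((EFin \o dF) \_ (cbox a b c d)).
  by apply/(integrable_mkcond _ mB); exact: continuous_integrable_cbox.
rewrite /Rintegral integral_mkcond.
rewrite -(integral21_prod_meas1 iB) integral0_eq// => y _; rewrite /fubini_G.
transitivity (\int[lebesgue_measure]_(x in `[a, b])
   (if y \in `[c, d] then dF (x, y) else 0)%:E)%E.
  rewrite [RHS]integral_mkcond; apply: eq_integral => x _.
  rewrite !patchE /=.
  have -> : ((x, y) \in cbox a b c d) = (x \in `[a, b]%classic) && (y \in `[c, d]).
    apply/idP/andP => [/set_mem [/= x1 y1]|[/set_mem x1 y1]]; last exact/mem_set.
    by split => //; exact/mem_set.
  by case: (x \in _) => //=; case: ifP.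
case: (y \in `[c, d]); last by rewrite integral0.
apply: (@integral_derive0 _ (fun x => F (x, y))) => //; last by move=> x; exact: (HF (x, y)).
move=> x; apply: (@cvg_comp _ _ _ (fun t : R => (t, y)) dF _ (nbhs (x, y))).
  by apply: (@cvg_pair _ _ _ (nbhs x) (nbhs x) (nbhs y)); [exact: cvg_id|exact: cvg_cst].
exact: cdF.
Qed.

Lemma integral_partial2 (R : realType) (F dF : R * R -> R) (a b c d : R) : c < d ->
  continuous dF -> (forall x : R * R, is_derive x.2 1 (fun t : R => F (x.1, t)) (dF x)) ->
  (forall x, F (x, c) = 0) -> (forall x, F (x, d) = 0) ->
  \int[leb2]_(x in cbox a b c d) dF x = 0.
Proof.
move=> cd cdF HF Fc Fd.
have mB := @measurable_cbox R a b c d.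
have iB : leb2.-integrable setT ((EFin \o dF) \_ (cbox a b c d)).
  by apply/(integrable_mkcond _ mB); exact: continuous_integrable_cbox.
rewrite /Rintegral integral_mkcond.
rewrite -(integral12_prod_meas1 iB) integral0_eq// => x _; rewrite /fubini_F.
transitivity (\int[lebesgue_measure]_(y in `[c, d])
   (if x \in `[a, b] then dF (x, y) else 0)%:E)%E.
  rewrite [RHS]integral_mkcond; apply: eq_integral => y _.
  rewrite !patchE /=.
  have -> : ((x, y) \in cbox a b c d) = (y \in `[c, d]%classic) && (x \in `[a, b]).
    apply/idP/andP => [/set_mem [/= x1 y1]|[/set_mem y1 x1]]; last exact/mem_set.
    by split => //; exact/mem_set.
  by case: (y \in _) => //=; case: ifP.
case: (x \in `[a, b]); last by rewrite integral0.
apply: (@integral_derive0 _ (fun y => F (x, y))) => //; last by move=> y; exact: (HF (x, y)).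
move=> y; apply: (@cvg_comp _ _ _ (fun t : R => (x, t)) dF _ (nbhs (x, y))).
  by apply: (@cvg_pair _ _ _ (nbhs y) (nbhs x) (nbhs y)); [exact: cvg_cst|exact: cvg_id].
exact: cdF.
Qed.

Lemma integral_partial (R : realType) (v : R * R) (F dF : R * R -> R) (a b c d : R) :
  v = e1 \/ v = e2 -> a < b -> c < d -> continuous dF ->
  (forall x, is_derive x v F (dF x)) ->
  (forall x, ~~ ((a < x.1 < b) && (c < x.2 < d)) -> F x = 0) ->
  \int[leb2]_(x in cbox a b c d) dF x = 0.
Proof.
move=> [->|->] ab cd cdF HF F0.
  apply: (@integral_partial1 _ F) => //; first by move=> x; exact/is_derive_e1P.
    by move=> y; apply: F0; rewrite /= ltxx.
  by move=> y; apply: F0; rewrite /= ltxx andbF.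
apply: (@integral_partial2 _ F) => //; first by move=> x; exact/is_derive_e2P.
  by move=> y; apply: F0; rewrite /= ltxx andbF.
by move=> y; apply: F0; rewrite /= ltxx !andbF.
Qed.

Lemma box_bump_boundary (R : realType) (a b c d : R) n (x : R * R) :
  ~~ ((a < x.1 < b) && (c < x.2 < d)) -> box_bump a b c d n x = 0.
Proof.
by rewrite negb_and /box_bump => /orP[/itv_bump_out ->|/itv_bump_out ->]; rewrite ?mul0r ?mulr0.
Qed.

Lemma derive_box_bump_out (R : realType) (a b c d : R) n (v x : R * R) :
  ~ cbox a b c d x -> 'D_v (box_bump a b c d n) x = 0.
Proof.
move=> Bx; rewrite (@near_eq_derive _ _ _ _ (cst 0)) ?derive_cst//.
have oC := closed_openC (@closed_cbox R a b c d).
apply: (filterS _ (open_nbhs_nbhs (conj oC Bx))).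
by move=> y /box_bump_out ->.
Qed.

(** Tested against a bump psi, the difference g - df gives minus the integral of a
    partial derivative of f * psi over a box on whose boundary psi vanishes. *)
Lemma weak_deriv_classical (R : realType) (Omega U : set (R * R)) (v : R * R)
    (u g f df : R * R -> R) :
  open Omega -> bounded_set Omega -> v = e1 \/ v = e2 -> L2 Omega u ->
  weak_derivs Omega v u g -> open U -> U `<=` Omega ->
  continuous f -> continuous df -> (forall x, is_derive x v f (df x)) ->
  ae_on U (fun x => u x = f x) -> ae_on U (fun x => g x = df x).
Proof.
move=> oO bO ve u2 [g2 wg] oU UO cf cdf fd uf.
have mO := open_measurable_plane oO.
have f2 := continuous_L2 oO bO cf; have df2 := continuous_L2 oO bO cdf.
have : ae_on U (fun x => g x + (-1) * df x = 0).
  apply: (box_bump_integral0_ae0 oO bO oU UO) => //; first exact: L2_lin.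
  move=> a b c d n ab cd BU; have BO := subset_trans BU UO.
  have tpsi := test_function_box_bump n BO.
  set psi := box_bump a b c d n in tpsi *.
  have psi2 := test_function_L2 oO bO tpsi.
  have cD : continuous ('D_v psi).
    case: tpsi => /(_ 1)[_ [_ [[c1 _] [c2 _]]]] _ _.
    by case: ve => ->; [exact: c1|exact: c2].
  have D2 := continuous_L2 oO bO cD.
  have mB := @measurable_cbox R a b c d.
  have iBc (h : R * R -> R) : continuous h -> leb2.-integrable (cbox a b c d) (EFin \o (h : plane R -> R)).
    exact: continuous_integrable_cbox.
  have cpsi : continuous psi by exact: box_bump_continuous.
  have cM (h1 h2 : R * R -> R) : continuous h1 -> continuous h2 -> continuous (fun x : R * R => h1 x * h2 x : R).
    by move=> k1 k2 x; apply: cvgM; [exact: k1|exact: k2].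
  transitivity (\int[leb2]_(x in Omega) (g x * psi x) -
                \int[leb2]_(x in Omega) (df x * psi x)).
    rewrite -RintegralB//; do ?exact: (L2_mul mO).
    by apply: eq_Rintegral => x _; rewrite mulrDl mulN1r mulNr.
  have E1 : \int[leb2]_(x in Omega) (g x * psi x) =
      - \int[leb2]_(x in cbox a b c d) (f x * 'D_v psi x).
    rewrite -[LHS]opprK -(wg _ tpsi).
    rewrite (@Rintegral_support _ _ (cbox a b c d))//; last first.
      by move=> x Bx; rewrite derive_box_bump_out// mulr0.
    congr (- _); apply: ae_eq_Rintegral => //.
    - have /integrableP[/measurable_EFinP + _] := L2_mul mO u2 D2.
      exact: measurable_funS.
    - by have /integrableP[/measurable_EFinP] := iBc _ (cM _ _ cf cD).
    - move: uf; rewrite /ae_on; apply: filterS => x H Bx; rewrite H//.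
      exact: BU.
  rewrite E1 (@Rintegral_support _ Omega (cbox a b c d) (fun x => df x * psi x))//; last first.
    by move=> x Bx; rewrite /psi box_bump_out// mulr0.
  rewrite -opprD -RintegralD//; last 2 first.
    exact: iBc (cM _ _ cf cD).
    exact: iBc (cM _ _ cdf cpsi).
  apply/eqP; rewrite oppr_eq0; apply/eqP.
  apply: (@integral_partial _ v (f * psi) _ a b c d ve ab cd).
  - by move=> x; apply: cvgD; [exact: (cM _ _ cf cD)|exact: (cM _ _ cdf cpsi)].
  - move=> x.
    have dpsi : is_derive x v psi ('D_v psi x).
      by split => //; case: tpsi => /(_ 1)[_ [+ _]] _ _; exact.
    have H := is_deriveM (fd x) dpsi; apply: (is_derive_eq H).
    by rewrite /GRing.scale/= [psi x * _]mulrC.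
  - by move=> x H; rewrite mulrfctE /psi box_bump_boundary// mulr0.
by apply: ae_on_mono => x _ /eqP; rewrite mulN1r subr_eq0 => /eqP.
Qed.

(** * Polynomials in two variables *)

Lemma continuous_bigsum (R : realType) n (F : 'I_n -> R * R -> R) :
  (forall i, continuous (F i)) -> continuous (fun x : R * R => \sum_(i < n) F i x).
Proof.
elim: n F => [|n IH] F cF.
  by under eq_fun do rewrite big_ord0; move=> x; exact: cvg_cst.
under eq_fun do rewrite big_ord_recr /=.
by move=> x; apply: cvgD; [apply: IH => i; exact: cF|exact: cF].
Qed.

Definition monomial (R : realType) (ij : nat * nat) : R * R -> R :=
  fun x => x.1 ^+ ij.1 * x.2 ^+ ij.2.

Lemma continuous_monomial (R : realType) (ij : nat * nat) :
  continuous (monomial (R := R) ij).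
Proof.
by apply: (@continuous_prod R (fun t => t ^+ ij.1) (fun t => t ^+ ij.2)) => t;
  exact: exprn_continuous.
Qed.

Lemma poly2_continuous (R : realType) k (c : nat -> nat -> R) : continuous (poly2 k c).
Proof.
rewrite /poly2; apply: continuous_bigsum => i; apply: continuous_bigsum => j.
have -> : (fun x : R * R => c i j * x.1 ^+ i * x.2 ^+ j) =
    (fun x => c i j * monomial (val i, val j) x).
  by apply/funext => x; rewrite mulrA.
by move=> x; apply: cvgM; [exact: cvg_cst|exact: continuous_monomial].
Qed.

Lemma is_derive_bigsum (R : realType) n (F : 'I_n -> R -> R) (dF : 'I_n -> R) (x : R) :
  (forall i, is_derive x 1 (F i) (dF i)) ->
  is_derive x 1 (fun t : R => \sum_(i < n) F i t) (\sum_(i < n) dF i).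
Proof.
elim: n F dF => [|n IH] F dF HF.
  by under eq_fun do rewrite big_ord0; rewrite big_ord0; exact: is_derive_cst.
under eq_fun do rewrite big_ord_recr /=.
rewrite big_ord_recr /=.
exact: is_deriveD (IH _ _ (fun i => HF _)) (HF _).
Qed.

Lemma is_derive_monomial (R : realType) (a : R) i (x : R) :
  is_derive x 1 (fun t : R => a * t ^+ i) (a * (i%:R * x ^+ i.-1)).
Proof.
have H := is_deriveZ a (is_deriveX i (is_derive_id x 1)).
rewrite (_ : (fun t => _) = a \*: (id ^+ i)); last first.
  by apply/funext => t; rewrite /= exprfctE.
by apply: (is_derive_eq H); rewrite /GRing.scale/= mulr1.
Qed.

(** The sum over i loses its constant term; after the shift of i the inner range
    is exactly the one of degree k. *)
Lemma is_derive_poly2_e1 (R : realType) k (c : nat -> nat -> R) (x : R * R) :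
  is_derive x e1 (poly2 k.+1 c) (poly2 k (fun i j => c i.+1 j * i.+1%:R) x).
Proof.
apply/is_derive_e1P; rewrite /poly2 /=.
rewrite (_ : (fun t => _) = (fun t : R => \sum_(i < k.+2) \sum_(j < (k.+1 - i).+1)
    (c i j * x.2 ^+ j) * t ^+ i)); last first.
  by apply/funext => t; apply: eq_bigr => i _; apply: eq_bigr => j _; rewrite mulrAC.
have H := is_derive_bigsum (fun i : 'I_k.+2 =>
  is_derive_bigsum (fun j : 'I_(k.+1 - i).+1 =>
     is_derive_monomial (c i j * x.2 ^+ j) i x.1)).
apply: (is_derive_eq H).
rewrite big_ord_recl /= big1 ?add0r; last by move=> j _; rewrite mul0r mulr0.
apply: eq_bigr => i _; rewrite /bump /= add1n subSS; apply: eq_bigr => j _.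
by rewrite mulrA [in RHS]mulrAC -!mulrA [x.2 ^+ j * _]mulrC -!mulrA; congr (_ * (_ * _)); rewrite mulrC.
Qed.

(** The terms with i = k + 1 only have j = 0 and disappear; the shift of j
    reindexes the others. *)
Lemma is_derive_poly2_e2 (R : realType) k (c : nat -> nat -> R) (x : R * R) :
  is_derive x e2 (poly2 k.+1 c) (poly2 k (fun i j => c i j.+1 * j.+1%:R) x).
Proof.
apply/is_derive_e2P; rewrite /poly2 /=.
have H := is_derive_bigsum (fun i : 'I_k.+2 =>
  is_derive_bigsum (fun j : 'I_(k.+1 - i).+1 =>
     is_derive_monomial (c i j * x.1 ^+ i) j x.2)).
apply: (is_derive_eq H).
rewrite big_ord_recr /= [X in _ + X]big1 ?addr0; last first.
  by move=> [j]/=; rewrite subnn ltnS leqn0 => /eqP -> _; rewrite mul0r mulr0.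
apply: eq_bigr => i _; rewrite big_ord_recl /= mul0r mulr0 add0r.
have ik : (i <= k)%N by rewrite -ltnS.
rewrite subSn//; apply: eq_bigr => j _; rewrite /bump /= add1n.
by rewrite mulrA; congr (_ * _); rewrite mulrAC.
Qed.

(** * Triangles and triangulations *)

Section triangle.
Context (R : realType) (t : marked_triangle R).
Hypothesis nd : nondegenerate t.
Let p := apex t.
Let q := base1 t.
Let r := base2 t.
Let D := (q.1 - p.1) * (r.2 - p.2) - (q.2 - p.2) * (r.1 - p.1).

(** Barycentric coordinate with respect to the vertex [base1 t], by Cramer's rule. *)
Definition bary1 (x : R * R) : R :=
  ((x.1 - p.1) * (r.2 - p.2) - (x.2 - p.2) * (r.1 - p.1)) / D.
(** Barycentric coordinate with respect to the vertex [base2 t], by Cramer's rule. *)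
Definition bary2 (x : R * R) : R :=
  ((q.1 - p.1) * (x.2 - p.2) - (q.2 - p.2) * (x.1 - p.1)) / D.

Lemma baryK x : x = (1 - bary1 x - bary2 x) *: p + bary1 x *: q + bary2 x *: r.
Proof.
have D0 : D != 0 by [].
rewrite /bary1 /bary2 [LHS]surjective_pairing; apply/pair_equal_spec; split => /=.
  apply: (mulfI D0); rewrite /GRing.scale/=.
  set N1 := (X in X / D); set N2 := (X in _ - X / D).
  transitivity (D * p.1 + N1 * (q.1 - p.1) + N2 * (r.1 - p.1)).
    by rewrite /D /N1 /N2; lra.
  have E1 : D * (N1 / D) = N1 by rewrite mulrCA divff// mulr1.
  have E2 : D * (N2 / D) = N2 by rewrite mulrCA divff// mulr1.
  move: (N1 / D) (N2 / D) E1 E2 => b c <- <-; lra.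
apply: (mulfI D0); rewrite /GRing.scale/=.
set N1 := (X in X / D); set N2 := (X in _ - X / D).
transitivity (D * p.2 + N1 * (q.2 - p.2) + N2 * (r.2 - p.2)).
  by rewrite /D /N1 /N2; lra.
have E1 : D * (N1 / D) = N1 by rewrite mulrCA divff// mulr1.
have E2 : D * (N2 / D) = N2 by rewrite mulrCA divff// mulr1.
move: (N1 / D) (N2 / D) E1 E2 => b c <- <-; lra.
Qed.

Lemma bary_unique a b c x : a + b + c = 1 -> x = a *: p + b *: q + c *: r ->
  bary1 x = b /\ bary2 x = c.
Proof.
have D0 : D != 0 by [].
move=> abc; have -> : a = 1 - b - c by lra.
move=> ->; rewrite /bary1 /bary2 /GRing.scale/=; split; apply: (mulIf D0); rewrite divfK//.
  by rewrite /D /GRing.scale/=; lra.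
by rewrite /D /GRing.scale/=; lra.
Qed.

(** Makes the topology accessible: the coordinates are continuous functions of
    the point. *)
Lemma carrierE : carrier t = [set x | [/\ 0 <= bary1 x, 0 <= bary2 x &
  bary1 x + bary2 x <= 1]].
Proof.
apply/seteqP; split => x.
  move=> [a [b [c [a0 b0 c0 abc xE]]]]; rewrite /=; have [-> ->] := bary_unique abc xE.
  by split => //; lra.
move=> [b0 c0 bc]; exists (1 - bary1 x - bary2 x), (bary1 x), (bary2 x).
split=> //; [lra|lra|exact: baryK].
Qed.

Lemma continuous_bary1 : continuous bary1.
Proof.
move=> x; apply: cvgM; last exact: cvg_cst.
by apply: cvgB; apply: cvgM; try exact: cvg_cst; apply: cvgB; try exact: cvg_cst;
  [exact: cvg_fst|exact: cvg_snd].
Qed.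

Lemma continuous_bary2 : continuous bary2.
Proof.
move=> x; apply: cvgM; last exact: cvg_cst.
by apply: cvgB; apply: cvgM; try exact: cvg_cst; apply: cvgB; try exact: cvg_cst;
  [exact: cvg_snd|exact: cvg_fst].
Qed.

Let b12 : continuous (fun x => bary1 x + bary2 x).
Proof. by move=> x; apply: cvgD; [exact: continuous_bary1|exact: continuous_bary2]. Qed.

Lemma closed_carrier : closed (carrier t).
Proof.
rewrite carrierE.
have -> : [set x | [/\ 0 <= bary1 x, 0 <= bary2 x & bary1 x + bary2 x <= 1]] =
   bary1 @^-1` [set y | 0 <= y] `&` bary2 @^-1` [set y | 0 <= y] `&`
   (fun x => bary1 x + bary2 x) @^-1` [set y | y <= 1].
  by apply/seteqP; split => [x [? ? ?]|x [[? ?] ?]].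
apply: closedI; first apply: closedI.
- by move/continuous_closedP : continuous_bary1; apply; exact: closed_ge.
- by move/continuous_closedP : continuous_bary2; apply; exact: closed_ge.
- by move/continuous_closedP : b12; apply; exact: closed_le.
Qed.

Definition open_triangle : set (R * R) := [set x | [/\ 0 < bary1 x, 0 < bary2 x &
  bary1 x + bary2 x < 1]].

Lemma open_open_triangle : open open_triangle.
Proof.
have -> : open_triangle =
   bary1 @^-1` [set y | 0 < y] `&` bary2 @^-1` [set y | 0 < y] `&`
   (fun x => bary1 x + bary2 x) @^-1` [set y | y < 1].
  by apply/seteqP; split => [x [? ? ?]|x [[? ?] ?]].
apply: openI; first apply: openI.
- by move/continuousP : continuous_bary1; apply; exact: open_gt.
- by move/continuousP : continuous_bary2; apply; exact: open_gt.
- by move/continuousP : b12; apply; exact: open_lt.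
Qed.

Lemma open_triangle_sub : open_triangle `<=` carrier t.
Proof. by rewrite carrierE => x [b0 c0 bc]; split; exact: ltW. Qed.

(** A point of the triangle with a vanishing barycentric coordinate lies on the
    opposite edge. *)
Lemma ae_open_triangle : ae_on (carrier t) open_triangle.
Proof.
rewrite /ae_on /almost_everywhere.
apply: (@negligibleS _ _ _ leb2 (segment q r `|` segment p r `|` segment p q)).
  move=> x /= /not_implyP[[a [b [c [a0 b0 c0 abc xE]]]] Vx].
  have [E1 E2] := bary_unique abc xE.
  move: (a0); rewrite le_eqVlt => /predU1P[a1|a1].
    left; left; exists c; first by lra.
    by rewrite xE -a1 scale0r add0r; congr (_ *: _ + _); lra.
  move: (b0); rewrite le_eqVlt => /predU1P[b1|b1].
    left; right; exists c; first by lra.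
    by rewrite xE -b1 scale0r addr0; congr (_ *: _ + _); lra.
  move: (c0); rewrite le_eqVlt => /predU1P[c1|c1].
    right; exists b; first by lra.
    by rewrite xE -c1 scale0r addr0; congr (_ *: _ + _); lra.
  by exfalso; apply: Vx; rewrite /open_triangle/= E1 E2; split => //; lra.
by do 2?apply: negligibleU; exact: negligible_segment.
Qed.

End triangle.

Lemma ae_carrierI (R : realType) (Omega : set (R * R)) (TT : set (marked_triangle R)) t t' :
  regular_triangulation Omega TT -> TT t -> TT t' -> t <> t' ->
  ae_on (carrier t) (fun x => ~ carrier t' x).
Proof.
move=> [_ _ _ H] Tt Tt' tt'; rewrite /ae_on /almost_everywhere.
apply: (@negligibleS _ _ _ leb2 (carrier t `&` carrier t')).
  by move=> x /= /not_implyP[xt /contrapT].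
have [->|[z _ ->]|[z [z' [_ _ _ ->]]]] := H _ _ Tt Tt' tt'.
- exact: negligible_set0.
- apply: negligibleS (negligible_segment z z) => _ ->.
  by exists 0; rewrite ?lexx ?ler01// scale0r addr0 subr0 scale1r.
- exact: negligible_segment.
Qed.

Lemma ae_polygonal_boundary (R : realType) (Omega : set (R * R)) :
  polygonal_boundary Omega -> ae_on (closure Omega) Omega.
Proof.
move=> [S OS]; rewrite /ae_on /almost_everywhere.
apply: (@negligibleS _ _ _ leb2 (closure Omega `\` Omega)).
  by move=> x /= /not_implyP[xt xO].
rewrite OS; elim: S {OS} => [|ab S IH].
  rewrite (_ : [set` [::]] = set0) ?bigcup_set0; first exact: negligible_set0.
  by apply/seteqP; split.
have -> : [set` ab :: S] = [set ab] `|` [set` S].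
  by apply/seteqP; split => z /=; rewrite in_cons => /predU1P.
rewrite bigcup_setU bigcup_set1; apply: negligibleU => //.
exact: negligible_segment.
Qed.

(** * The Curl of a discrete function is discrete *)

(** On the part of the open triangle inside the domain, u is almost everywhere a
    C1 function; the rest of the closed triangle is contained in the edges and
    in the polygonal boundary of the domain. *)
Lemma weak_deriv_Pk (R : realType) (Omega : set (R * R)) (k : nat)
    (TT : set (marked_triangle R)) (v : R * R) (u g : R * R -> R) :
  polygonal_lipschitz_domain Omega -> regular_triangulation Omega TT ->
  v = e1 \/ v = e2 -> Pk Omega k.+1 TT u -> weak_derivs Omega v u g ->
  Pk Omega k TT g.
Proof.
move=> [[oO _] _ bO pO _] [_ nd OT _] ve [u2 Hu] Hg.
split=> [|t Tt]; first by case: Hg.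
have [c uc] := Hu _ Tt.
have [df [c' dfE] fd] : exists2 df, exists c', df = poly2 k c' &
    forall x, is_derive x v (poly2 k.+1 c) (df x).
  case: ve => ->.
    by eexists; [eexists; reflexivity|move=> x; exact: is_derive_poly2_e1].
  by eexists; [eexists; reflexivity|move=> x; exact: is_derive_poly2_e2].
exists c'; rewrite -dfE.
pose U := Omega `&` open_triangle t.
have oU : open U by apply: openI => //; exact: open_open_triangle.
have ndt := nd _ Tt.
have tO : carrier t `<=` closure Omega by rewrite OT => x xt; exists t.
have UO : U `<=` Omega by apply: subIsetl.
have Ut : U `<=` carrier t by move=> x [_ /open_triangle_sub]; apply.
have cdf : continuous df by rewrite dfE; exact: poly2_continuous.
have gU : ae_on U (fun x => g x = df x).
  apply: (weak_deriv_classical oO bO ve u2 Hg oU UO _ cdf fd).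
    exact: poly2_continuous.
  exact: ae_on_sub Ut uc.
have tU : ae_on (carrier t) U.
  have A : ae_on (carrier t) Omega.
    exact: ae_on_sub tO (ae_polygonal_boundary pO).
  have := ae_on_and A (ae_open_triangle ndt).
  by apply: ae_on_mono => x _.
exact: ae_on_trans tU gU.
Qed.

Lemma Curl_Yh_Xh (R : realType) (Omega : set (R * R)) (k : nat)
    (TT : set (marked_triangle R)) (u : R * R -> R) :
  polygonal_lipschitz_domain Omega -> regular_triangulation Omega TT ->
  Yh Omega k TT u -> Xh Omega k TT (Curl Omega u).
Proof.
move=> dom reg [Pu [Hu _]].
have [p1 p1E] := weak_deriv_Pk dom reg (or_introl erefl) Pu (H1_weak_deriv (or_introl erefl) Hu).
have P2 := weak_deriv_Pk dom reg (or_intror erefl) Pu (H1_weak_deriv (or_intror erefl) Hu).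
split; first exact: P2.
have [[oO _] _ bO _ _] := dom.
have [C2 _] := Curl_L2v oO bO Hu.
split; first by have [] := Curl_L2v oO bO Hu.
move=> t Tt; have [c Hc] := p1E _ Tt; exists (fun i j => - c i j).
apply: ae_on_mono Hc => x _; rewrite /Curl /= => ->; rewrite /poly2 -sumrN.
apply: eq_bigr => i _; rewrite -sumrN; apply: eq_bigr => j _.
by rewrite !mulNr.
Qed.

(** * Projections in a semi-inner product space *)

Section semi_inner_product.
Context (R : realType) (V : lmodType R) (S : set V) (b : V -> V -> R).
Hypothesis S_lin : forall c u v, S u -> S v -> S (u + c *: v).
Hypothesis bC : forall u v, b u v = b v u.
Hypothesis b_lin : forall c u v w, S u -> S v -> S w ->
  b (u + c *: v) w = b u w + c * b v w.
Hypothesis b_ge0 : forall u, 0 <= b u u.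

Lemma b0r u : S 0 -> S u -> b u 0 = 0.
Proof.
move=> S0 Su; have := b_lin 1 S0 S0 Su.
by rewrite scaler0 addr0 mul1r [b u 0]bC; lra.
Qed.

Lemma b_sqr c u v : S u -> S v ->
  b (u + c *: v) (u + c *: v) = b u u + 2 * c * b u v + c ^+ 2 * b v v.
Proof.
move=> Su Sv; have Sw := S_lin c Su Sv.
rewrite b_lin// [b u _]bC [b v _]bC !b_lin// [b v u]bC; lra.
Qed.

Lemma cauchy_schwarz u v : S u -> S v -> b u v ^+ 2 <= b u u * b v v.
Proof.
move=> Su Sv; have [v0|v0] := eqVneq (b v v) 0.
  have [->|uv0] := eqVneq (b u v) 0; first by rewrite v0 expr0n mulr0.
  (* with this coefficient the square would be -1 *)
  have := b_ge0 (u + (- (b u u + 1) / (2 * b u v)) *: v).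
  rewrite b_sqr// v0 mulr0 addr0 [2 * _]mulrC -mulrA.
  rewrite -[_ / _ * _]mulrA mulVf ?mulr1; last by rewrite mulf_neq0// pnatr_eq0.
  by rewrite opprD addrA subrr add0r oppr_ge0 ler10.
have vgt0 : 0 < b v v by rewrite lt_def v0 b_ge0.
(* the coefficient that minimizes the square of the norm *)
have := b_ge0 (u + (- b u v / b v v) *: v); rewrite b_sqr//.
rewrite -(pmulr_rge0 _ vgt0).
have E : b v v * (- b u v / b v v) = - b u v by rewrite mulrCA divff// mulr1.
move: (- b u v / b v v) E => c E.
have -> : b v v * (b u u + 2 * c * b u v + c ^+ 2 * b v v) =
  b u u * b v v + 2 * (b v v * c) * b u v + (b v v * c) ^+ 2 by rewrite !expr2; lra.
by rewrite E !expr2; lra.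
Qed.

Lemma cauchy_schwarz_sqrt u v : S u -> S v ->
  `|b u v| <= Num.sqrt (b u u) * Num.sqrt (b v v).
Proof.
move=> Su Sv; rewrite -sqrtrM// -sqrtr_sqr ler_wsqrtr//.
exact: cauchy_schwarz.
Qed.

Lemma seminormD u v : S u -> S v ->
  Num.sqrt (b (u + v) (u + v)) <= Num.sqrt (b u u) + Num.sqrt (b v v).
Proof.
move=> Su Sv; rewrite -[leRHS]ger0_norm ?addr_ge0 ?sqrtr_ge0//.
rewrite -sqrtr_sqr ler_wsqrtr// sqrrD !sqr_sqrtr//.
rewrite -[v in b (u + v)]scale1r -[v in b _ (u + v)]scale1r b_sqr// expr1n !mul1r mulr1.
have := cauchy_schwarz_sqrt Su Sv; have := ler_norm (b u v).
set x := _ * _ => h1 h2; rewrite -/x [x *+ 2]mulr2n.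
by have := le_trans h1 h2; lra.
Qed.

(** Pythagoras. *)
Lemma orthogonal_minimal u z : S u -> S z -> b u z = 0 ->
  Num.sqrt (b u u) <= Num.sqrt (b (u + z) (u + z)).
Proof.
move=> Su Sz uz; apply: ler_wsqrtr.
by rewrite -[z]scale1r b_sqr// uz mulr0 addr0 expr1n mul1r lerDl.
Qed.

(** The abstract error estimate: the best approximation q of p in W is compared
    with ph by means of d = q - ph, for which |d|^2 = - (d, e). *)
Lemma quasi_optimal (W : set V) p ph q e : W `<=` S ->
  (forall c u v, W u -> W v -> W (u + c *: v)) -> S p -> S e -> W ph -> W q ->
  (forall w, W w -> b (p - q) w = 0) ->
  (forall w, W w -> b (p - ph) w + b w e = 0) ->
  Num.sqrt (b (p - ph) (p - ph)) <= Num.sqrt (b (p - q) (p - q)) + Num.sqrt (b e e).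
Proof.
move=> WS Wlin Sp Se Wph Wq Hq He.
have Wd : W (q - ph) by rewrite -scaleN1r; exact: Wlin.
have Sd := WS _ Wd; have Spq : S (p - q) by rewrite -scaleN1r; apply: S_lin => //; exact: WS.
have Sph : S (p - ph) by rewrite -scaleN1r; apply: S_lin => //; exact: WS.
have dE : p - ph = (p - q) + (q - ph) by rewrite addrA subrK.
have dd : b (q - ph) (q - ph) = - b (q - ph) e.
  have := He _ Wd; rewrite dE -[X in b (_ + X) _]scale1r b_lin// Hq// mul1r add0r.
  by move/eqP; rewrite addr_eq0 => /eqP.
rewrite {1 2}dE; apply: le_trans (seminormD Spq Sd) _; rewrite lerD2l.
have := cauchy_schwarz_sqrt Sd Se; rewrite -normrN -dd ger0_norm//.
rewrite -{1}[b (q - ph) (q - ph)]sqr_sqrtr// expr2.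
have [->|d0] := eqVneq (Num.sqrt (b (q - ph) (q - ph))) 0; first by rewrite sqrtr_ge0.
by rewrite ler_pM2l// lt_def d0 sqrtr_ge0.
Qed.

(** Recursive, so that projections can be computed by adding one vector at a time. *)
Fixpoint in_span (s : seq V) (u : V) : Prop :=
  if s is v :: s' then exists c w, in_span s' w /\ u = w + c *: v else u = 0.

Lemma in_span_lin s c u v : in_span s u -> in_span s v -> in_span s (u + c *: v).
Proof.
elim: s u v => [|x s IH] u v /=; first by move=> -> ->; rewrite scaler0 addr0.
move=> [d [w [sw ->]]] [e [z [sz ->]]]; exists (d + c * e), (w + c *: z).
split; first exact: IH.
by rewrite scalerDr scalerDl scalerA addrACA.
Qed.

Lemma in_span0 s : in_span s 0.
Proof. by elim: s => //= x s IH; exists 0, 0; rewrite scale0r addr0. Qed.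

Lemma in_span_mem s v : v \in s -> in_span s v.
Proof.
elim: s => //= x s IH; rewrite in_cons => /predU1P[->|/IH vs].
  by exists 1, 0; rewrite scale1r add0r; split => //; exact: in_span0.
by exists 0, v; rewrite scale0r addr0.
Qed.

Lemma in_span_sub (W : set V) s : W 0 ->
  (forall c u v, W u -> W v -> W (u + c *: v)) -> (forall v, v \in s -> W v) ->
  in_span s `<=` W.
Proof.
move=> W0 Wlin; elim: s => [|x s IH] Ws u /=; first by move=> ->.
move=> [c [w [sw ->]]]; apply: Wlin; last by apply: Ws; rewrite mem_head.
by apply: IH sw => v vs; apply: Ws; rewrite in_cons vs orbT.
Qed.

(** One step of Gram-Schmidt: the new vector x and the point p are first reduced
    by their projections on the old span, then p is reduced along the remainder
    of x.  If this remainder has norm zero, Cauchy-Schwarz shows that it is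
    already orthogonal to everything. *)
Lemma orthogonal_projection s p : (forall v, v \in s -> S v) -> S 0 -> S p ->
  exists2 q, in_span s q & forall w, in_span s w -> b (p - q) w = 0.
Proof.
move=> Ss S0 Sp; elim: s p Ss Sp => [|x s IH] p Ss Sp.
  exists 0 => // w /= ->.
  by rewrite subr0; exact: b0r.
have Ss' v : v \in s -> S v by move=> vs; apply: Ss; rewrite in_cons vs orbT.
have Sx : S x by apply: Ss; rewrite mem_head.
have spS : in_span s `<=` S by apply: in_span_sub.
have [q sq Hq] := IH _ Ss' Sp; have [y sy Hy] := IH _ Ss' Sx.
have Sq := spS _ sq; have Sy := spS _ sy.
have Sxy : S (x - y) by rewrite -scaleN1r; exact: S_lin.
have Spq : S (p - q) by rewrite -scaleN1r; exact: S_lin.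
(* if the denominator is zero, so is c, as division by zero yields zero *)
pose c := b (p - q) (x - y) / b (x - y) (x - y).
exists (q - c *: y + c *: x).
  exists c, (q - c *: y); split=> //; rewrite -scaleNr; exact: in_span_lin.
have -> : p - (q - c *: y + c *: x) = (p - q) + (- c) *: (x - y).
  by rewrite scalerBr !scaleNr opprK !opprD opprK !addrA addrAC.
move=> _ [d [w [sw ->]]].
have -> : w + d *: x = (w + d *: y) + d *: (x - y).
  by rewrite scalerBr -addrA [d *: y + _]addrC subrK.
have sz : in_span s (w + d *: y) by exact: in_span_lin.
have Sz := spS _ sz; have Szxy : S (w + d *: y + d *: (x - y)) by exact: S_lin.
have blr e u v z : S u -> S v -> S z -> b z (u + e *: v) = b z u + e * b z v.
  by move=> Su Sv Sz'; rewrite bC b_lin// ![b _ z]bC.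
move: (w + d *: y) sz Sz Szxy => z sz Sz Szxy.
rewrite b_lin// !blr// Hq// Hy// !add0r.
have [xy0|xy0] := eqVneq (b (x - y) (x - y)) 0.
  have := cauchy_schwarz Spq Sxy; rewrite xy0 mulr0 => H.
  have /eqP : b (p - q) (x - y) ^+ 2 = 0 by apply/eqP; rewrite eq_le H sqr_ge0.
  by rewrite sqrf_eq0 => /eqP ->; rewrite !mulr0 addr0.
have E : c * b (x - y) (x - y) = b (p - q) (x - y) by rewrite divfK.
by rewrite [- c * _]mulrCA mulNr E -mulrDr subrr mulr0.
Qed.

End semi_inner_product.

(** * Piecewise polynomials form a finite-dimensional space *)

(* Classical equality, so that a finite triangulation can be listed without repetition. *)
HB.instance Definition _ (R : realType) := gen_eqMixin (marked_triangle R).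

Definition exponents (k : nat) : seq (nat * nat) :=
  [seq (i, j) | i <- iota 0 k.+1, j <- iota 0 (k - i).+1].

(** Monomials cut off outside a triangle; jumps across edges are allowed, so these
    are piecewise polynomials. *)
Definition Pk_basis (R : realType) (k : nat) (s : seq (marked_triangle R)) :
    seq (R * R -> R) :=
  [seq (monomial (R := R) ij) \_ (carrier t) | t <- s, ij <- exponents k].

Lemma exponentsP k i j : reflect (i <= k /\ j <= k - i)%N ((i, j) \in exponents k).
Proof.
apply: (iffP allpairsPdep) => [[i' [j' [+ + [-> ->]]]]|[ik jk]].
  by rewrite !mem_iota !add0n !ltnS.
by exists i, j; rewrite !mem_iota !add0n !ltnS.
Qed.

Lemma poly2_monomial (R : realType) k i j (x : R * R) : (i <= k)%N -> (j <= k - i)%N ->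
  poly2 k (fun i' j' => ((i' == i) && (j' == j))%:R) x = monomial (i, j) x.
Proof.
move=> ik jk; rewrite /poly2 (bigD1 (Ordinal (ik : (i < k.+1)%N)))//=.
rewrite [X in _ + X]big1 ?addr0; last first.
  move=> i' i'i; apply: big1 => j' _.
  have -> : (i' == i :> nat) = false by apply/negbTE.
  by rewrite /= !mul0r.
rewrite (bigD1 (Ordinal (jk : (j < (k - i).+1)%N)))//= !eqxx mul1r.
rewrite big1 ?addr0// => j' j'j.
have -> : (j' == j :> nat) = false by apply/negbTE.
by rewrite /= !mul0r.
Qed.

Section piecewise_polynomials.
Context (R : realType) (Omega : set (R * R)) (k : nat) (TT : set (marked_triangle R)).
Hypotheses (oO : open Omega) (bO : bounded_set Omega).
Hypothesis reg : regular_triangulation Omega TT.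
Let mO := open_measurable_plane oO.

Lemma Pk_lin (c : R) f g : Pk Omega k TT f -> Pk Omega k TT g ->
  Pk Omega k TT (fun x => f x + c * g x).
Proof.
move=> [f2 Hf] [g2 Hg]; split; first exact: L2_lin.
move=> t Tt; have [cf {}Hf] := Hf _ Tt; have [cg {}Hg] := Hg _ Tt.
exists (fun i j => cf i j + c * cg i j).
have := ae_on_and Hf Hg; apply: ae_on_mono => x _ [-> ->].
rewrite /poly2 mulr_sumr -big_split/=; apply: eq_bigr => i _.
rewrite mulr_sumr -big_split/=; apply: eq_bigr => j _.
by rewrite !mulrDl !mulrA.
Qed.

Lemma L2_patch (A : set (R * R)) (f : R * R -> R) : closed A -> continuous f ->
  L2 Omega (f \_ A).
Proof.
move=> cA cf; have [M OM] := bounded_sub_cbox bO => BM.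
have [N N0 fN] := cbox_bounded (- M) M (- M) M cf.
have mA := closed_measurable_plane cA.
apply: (@L2_bounded _ _ mO _ N).
- exact: bounded_leb2_fin.
- have : measurable_fun setT ((f : plane R -> R) \_ A).
    apply/(measurable_restrictT _ mA).
    exact: measurable_funS (continuous_measurable_plane cf).
  by apply: measurable_funS.
- move=> x /BM xM; rewrite patchE; case: ifP => _; first exact: fN.
  by rewrite normr0 ltW.
Qed.

Lemma Pk_basis_Pk (s : seq (marked_triangle R)) (e : R * R -> R) :
  TT = [set` s] -> e \in Pk_basis k s -> Pk Omega k TT e.
Proof.
move=> TTs /allpairsP[[t [i j]] /= [ts /exponentsP[ik jk] ->]].
have Tt : TT t by rewrite TTs.
have ndt : nondegenerate t by case: reg => _ /(_ _ Tt).
split; first by apply: L2_patch; [exact: closed_carrier|exact: continuous_monomial].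
move=> t' Tt'; have [<-|tt'] := pselect (t = t').
  exists (fun i' j' => ((i' == i) && (j' == j))%:R).
  by apply: ae_on_all => x xt; rewrite poly2_monomial// patchE mem_set.
exists (fun _ _ => 0).
have := ae_carrierI reg Tt' Tt (fun e => tt' (esym e)).
apply: ae_on_mono => x _ xt; rewrite patchE memNset//.
by rewrite /poly2 big1// => ? _; rewrite big1// => ? _; rewrite !mul0r.
Qed.

Lemma ae_on_triangulation (s : seq (marked_triangle R)) (P : R * R -> Prop) :
  TT = [set` s] -> (forall t, TT t -> ae_on (carrier t) P) -> ae_on Omega P.
Proof.
move=> TTs HP.
have OT : Omega `<=` \bigcup_(t in [set` s]) carrier t.
  by rewrite -TTs; case: reg => _ _ <- _; exact: subset_closure.
apply: (ae_on_sub OT).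
(* induction over the triangles, forgetting that they cover the domain *)
have {}HP : forall t, t \in s -> ae_on (carrier t) P by move=> t ts; apply: HP; rewrite TTs.
elim: s HP {TTs OT} => [|t s IH] HP.
  by apply: ae_on_all => x [].
have A := HP t (mem_head _ _).
have B : ae_on (\bigcup_(t in [set` s]) carrier t) P.
  by apply: IH => t' t's; apply: HP; rewrite in_cons t's orbT.
apply: ae_on_sub (ae_onU A B) => x [t' /=].
by rewrite in_cons => /predU1P[->|t's]; [left|right; exists t'].
Qed.

(** Almost every point of a triangle lies in no other triangle, so at such a point
    only one term of the sum over the triangles survives. *)
Lemma Pk_in_span (s : seq (marked_triangle R)) (f : R * R -> R) :
  TT = [set` s] -> uniq s -> Pk Omega k TT f ->
  exists2 w : R * R -> R, in_span (Pk_basis k s) w & ae_on Omega (fun x => f x = w x).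
Proof.
move=> TTs us [_ Hf].
have /choice[c Hc] : forall t, exists c : nat -> nat -> R, TT t ->
    ae_on (carrier t) (fun x => f x = poly2 k c x).
  move=> t; have [Tt|nTt] := pselect (TT t); last by exists (fun _ _ => 0).
  by have [c Hc] := Hf _ Tt; exists c.
pose w := \sum_(t <- s) \sum_(i < k.+1) \sum_(j < (k - i).+1)
   c t i j *: ((monomial (R := R) (val i, val j)) \_ (carrier t)).
have sum_span (I : eqType) (r : seq I) (F : I -> R * R -> R) :
    (forall i, i \in r -> in_span (Pk_basis k s) (F i)) ->
    in_span (Pk_basis k s) (\sum_(i <- r) F i).
  move=> HF; rewrite big_seq; apply: (big_ind (in_span (Pk_basis k s))); last exact: HF.
    exact: in_span0.
  by move=> u v su sv; rewrite -[v]scale1r; exact: in_span_lin.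
exists w.
  apply: (sum_span _) => t ts; apply: (sum_span _) => i _; apply: (sum_span _) => j _.
  rewrite -[_ *: _]add0r; apply: in_span_lin; first exact: in_span0.
  apply: in_span_mem; apply: allpairs_f => //.
  by apply/exponentsP; split; [exact: (ltn_ord i)|exact: (ltn_ord j)].
apply: (ae_on_triangulation TTs) => t Tt.
have wE x : w x = \sum_(t <- s) (poly2 k (c t) \_ (carrier t)) x.
  rewrite /w fct_sumE; apply: eq_bigr => t' _; rewrite fct_sumE patchE.
  case: ifP => xt.
    apply: eq_bigr => i _; rewrite fct_sumE; apply: eq_bigr => j _.
    by rewrite scalrfctE patchE xt /GRing.scale/= mulrA.
  rewrite big1// => i _; rewrite fct_sumE big1// => j _.
  by rewrite scalrfctE patchE xt scaler0.
have others : ae_on (carrier t) (fun x => forall t', t' \in s -> t' != t -> ~ carrier t' x).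
  have : forall t', t' \in s -> t' != t -> ae_on (carrier t) (fun x => ~ carrier t' x).
    move=> t' t's /eqP t't; apply: (ae_carrierI reg) => //; last exact/nesym.
    by rewrite TTs.
  elim: (s) => [|t1 r IH] H; first by apply: ae_on_all => x.
  have B := IH (fun t' t'r => H t' (mem_behead (s := t1 :: r) t'r)).
  have [t1t|t1t] := eqVneq t1 t.
    apply: ae_on_mono B => x _ K t'; rewrite in_cons => /predU1P[->|]; last exact: K.
    by rewrite t1t eqxx.
  have := ae_on_and (H _ (mem_head _ _) t1t) B; apply: ae_on_mono => x _ [K1 K] t'.
  by rewrite in_cons => /predU1P[->//|]; exact: K.
have := ae_on_and (Hc _ Tt) others; apply: ae_on_mono => x xt [-> H].
have ts : t \in s by move: Tt; rewrite TTs.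
rewrite wE (bigD1_seq t)//= patchE mem_set// big_seq_cond big1 ?addr0//.
by move=> t' /andP[t's t't]; rewrite patchE memNset//; exact: H.
Qed.

(** The projection is computed in the span of the basis; it remains orthogonal to
    all piecewise polynomials because these agree almost everywhere with
    elements of the span. *)
Lemma Pk_projection (f : R * R -> R) : L2 Omega f ->
  exists2 g, Pk Omega k TT g &
    forall h, Pk Omega k TT h -> innerL2 Omega (fun x => f x - g x) h = 0.
Proof.
move=> f2.
have [s us TTs] : exists2 s : seq (marked_triangle R), uniq s & TT = [set` s].
  have [/finite_seqP[s ->] _ _ _] := reg.
  exists (undup s); first exact: undup_uniq.
  by apply/seteqP; split => t /=; rewrite mem_undup.
have L20 : L2 Omega (0 : R * R -> R) by exact: (continuous_L2 oO bO (fun x => cvg_cst (0 : R))).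
have ps e : e \in Pk_basis k s -> Pk Omega k TT e by exact: Pk_basis_Pk.
have [g sg Hg] := @orthogonal_projection R _ (L2 Omega) (innerL2 Omega)
  (fun c u v => @L2_lin R Omega mO c u v) (@innerL2C R Omega)
  (fun c u v w => @innerL2_lin R Omega mO c u v w) (@innerL2_ge0 R Omega)
  (Pk_basis k s) f (fun e es => (ps e es).1) L20 f2.
have Pg : Pk Omega k TT g.
  apply: (in_span_sub _ _ ps sg).
    split=> // t _; exists (fun _ _ => 0); apply: ae_on_all => x _.
    by rewrite /poly2 big1// => ? _; rewrite big1// => ? _; rewrite !mul0r.
  by move=> c u v; exact: Pk_lin.
exists g => // h Ph; have [w sw hw] := Pk_in_span TTs us Ph.
have g2 := Pg.1; have fg2 : L2 Omega (fun x => f x - g x).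
  have := L2_lin mO (-1) f2 g2; congr L2; apply/funext => x; by rewrite mulN1r.
have w2 : L2 Omega w.
  apply: (in_span_sub _ _ _ sw) => //; last by move=> e /ps[].
  by move=> c u v; exact: L2_lin.
have Phw : innerL2 Omega (fun x => f x - g x) h = innerL2 Omega (fun x => f x - g x) w.
  have h2 := Ph.1.
  apply: (ae_eq_Rintegral mO).
  - by have /integrableP[/measurable_EFinP] := L2_mul mO fg2 h2.
  - by have /integrableP[/measurable_EFinP] := L2_mul mO fg2 w2.
  - by apply: ae_on_mono hw => x _ ->.
rewrite Phw; exact: Hg.
Qed.

End piecewise_polynomials.

(** * The best-approximation estimate *)

Section Galerkin.
Context (R : realType) (Omega : set (R * R)) (k : nat) (TT : set (marked_triangle R)).
Hypothesis dom : polygonal_lipschitz_domain Omega.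
Hypothesis reg : regular_triangulation Omega TT.
Let oO : open Omega. Proof. by case: dom => [[]]. Qed.
Let bO : bounded_set Omega. Proof. by case: dom. Qed.
Let mO := open_measurable_plane oO.
Implicit Types (p q : vector_field R).

Lemma Xh_L2v q : Xh Omega k TT q -> L2v Omega q.
Proof. by move=> [[? _] [? _]]. Qed.

Lemma Xh_lin (c : R) p q : Xh Omega k TT p -> Xh Omega k TT q ->
  Xh Omega k TT (fun x => p x + c *: q x).
Proof.
move=> [p1 p2] [q1 q2].
by split; [exact: (Pk_lin oO c p1 q1)|exact: (Pk_lin oO c p2 q2)].
Qed.

(** Componentwise, since the inner product of fields is the sum of those of the
    components. *)
Lemma Xh_projection p : L2v Omega p ->
  exists2 q, Xh Omega k TT q & forall w, Xh Omega k TT w -> innerv Omega (p \- q) w = 0.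
Proof.
move=> [p1 p2].
have [q1 Pq1 H1] := Pk_projection k oO bO reg p1.
have [q2 Pq2 H2] := Pk_projection k oO bO reg p2.
exists (fun x => (q1 x, q2 x)) => // w [w1 w2].
have sub (f g : R * R -> R) : L2 Omega f -> Pk Omega k TT g -> L2 Omega (fun x => f x - g x).
  move=> f2 [g2 _]; have := L2_lin mO (-1) f2 g2; congr L2.
  by apply/funext => x; rewrite mulN1r.
have i1 := L2_mul mO (sub _ _ p1 Pq1) w1.1.
have i2 := L2_mul mO (sub _ _ p2 Pq2) w2.1.
transitivity (innerL2 Omega (fun x => (p x).1 - q1 x) (fst \o w) +
   innerL2 Omega (fun x => (p x).2 - q2 x) (snd \o w)).
  by rewrite /innerL2 -RintegralD.
by rewrite (H1 _ w1) (H2 _ w2) addr0.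
Qed.

(** The Curl of a difference and the difference of the Curls are different
    representatives of one class, hence have the same norm. *)
Lemma Curl_sub (u v : R * R -> R) : H1 Omega u -> H1 Omega v ->
  normv Omega (Curl Omega (u \- v)) = normv Omega (Curl Omega u \- Curl Omega v).
Proof.
move=> Hu Hv.
have E : (u \- v) = (fun x => u x + (-1) * v x).
  by apply/funext => x; rewrite mulN1r.
have C2 : L2v Omega (Curl Omega (u \- v)) by rewrite E; apply: Curl_L2v => //; exact: H1_lin.
have D2 : L2v Omega (Curl Omega u \- Curl Omega v).
  have := L2v_lin mO (-1) (Curl_L2v oO bO Hu) (Curl_L2v oO bO Hv); congr L2v.
  by apply/funext => x; rewrite scaleN1r.
have ae : ae_on Omega (fun x => Curl Omega (u \- v) x = (Curl Omega u \- Curl Omega v) x).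
  rewrite E; apply: ae_on_mono (Curl_lin oO bO (-1) Hu Hv) => x _ ->.
  by rewrite scaleN1r.
rewrite /normv (ae_eq_innerv mO C2 D2 C2 ae) innervC.
by rewrite (ae_eq_innerv mO C2 D2 D2 ae).
Qed.

Theorem best_approximation phi p alpha ph alphah :
    mixed_solution Omega (Xspace Omega) (Yspace Omega) phi p alpha ->
    mixed_solution Omega (Xh Omega k TT) (Yh Omega k TT) phi ph alphah ->
  exists m1 m2 : R,
    [/\ is_min [set normv Omega (p \- qh) | qh in Xh Omega k TT] m1,
        is_min [set normv Omega (Curl Omega (alpha \- betah))
               | betah in Yh Omega k TT] m2 &
        normv Omega (p \- ph) + normv Omega (Curl Omega (alpha \- alphah))
          <= 2 * (m1 + m2)].
Proof.
move=> [p2 Ya eqX eqY] [Xph Yah eqXh eqYh].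
pose b : vector_field R -> vector_field R -> R := innerv Omega.
have b_lin := @innerv_linl R Omega mO : forall c (u v w : vector_field R),
  L2v Omega u -> L2v Omega v -> L2v Omega w -> b (u + c *: v) w = b u w + c * b v w.
have S_lin := @L2v_lin R Omega mO : forall c (u v : vector_field R),
  L2v Omega u -> L2v Omega v -> L2v Omega (u + c *: v).
have bC := @innervC R Omega : forall u v, b u v = b v u.
have b0 := @innerv_ge0 R Omega : forall u, 0 <= b u u.
have S_sub (u v : vector_field R) : L2v Omega u -> L2v Omega v -> L2v Omega (u - v).
  by move=> Su Sv; rewrite -scaleN1r; exact: S_lin.
have b_sub (u v w : vector_field R) : L2v Omega u -> L2v Omega v -> L2v Omega w ->
    b (u - v) w = b u w - b v w.
  by move=> Su Sv Sw; rewrite -scaleN1r b_lin// mulN1r.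
have Xh2 q : Xh Omega k TT q -> L2v Omega q := @Xh_L2v q.
have Ha := Ya.1; have Hah := Yah.2.1.
have ca := Curl_L2v oO bO Ha; have cah := Curl_L2v oO bO Hah.
pose e : vector_field R := Curl Omega alpha - Curl Omega alphah.
have e2 : L2v Omega e by exact: S_sub.
have [q Xq Hq] := Xh_projection p2.
have gal w : Xh Omega k TT w -> b (p - ph) w + b w e = 0.
  move=> Xw; have w2 := Xh2 _ Xw.
  have h1 := eqX _ w2; have h2 := eqXh _ Xw.
  rewrite (b_sub _ _ _ p2 (Xh2 _ Xph) w2) [b w e]bC (b_sub _ _ _ ca cah w2).
  rewrite [b (Curl Omega alpha) w]bC [b (Curl Omega alphah) w]bC /b.
  by rewrite addrACA h1 -opprD h2 subrr.
have orth w : Yh Omega k TT w -> b e (Curl Omega w) = 0.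
  move=> Yw; have Xw := Curl_Yh_Xh dom reg Yw; have w2 := Xh2 _ Xw.
  have := gal _ Xw; rewrite (b_sub _ _ _ p2 (Xh2 _ Xph) w2).
  by rewrite /b (eqY _ Yw.2) (eqYh _ Yw) subrr add0r innervC.
exists (normv Omega (p \- q)), (normv Omega (Curl Omega (alpha \- alphah))).
have NE : normv Omega (Curl Omega (alpha \- alphah)) = Num.sqrt (b e e).
  exact: Curl_sub.
split.
- split; first by exists q.
  move=> _ [w Xw <-].
  have Xqw : Xh Omega k TT (q - w : vector_field R).
    by rewrite -scaleN1r; exact: Xh_lin.
  have := @orthogonal_minimal R _ (L2v Omega) b S_lin bC b_lin b0 (p - q) (q - w)
     (S_sub _ _ p2 (Xh2 _ Xq)) (Xh2 _ Xqw) (Hq _ Xqw).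
  by rewrite addrA subrK.
- split; first by exists alphah.
  move=> _ [w Yw <-]; rewrite NE (Curl_sub Ha Yw.2.1).
  have cw := Curl_L2v oO bO Yw.2.1.
  have E : e + (Curl Omega alphah - Curl Omega w) = Curl Omega alpha - Curl Omega w.
    by rewrite addrA subrK.
  have := @orthogonal_minimal R _ (L2v Omega) b S_lin bC b_lin b0 e
    (Curl Omega alphah - Curl Omega w) e2 (S_sub _ _ cah cw).
  rewrite E; apply.
  by rewrite bC (b_sub _ _ _ cah cw e2) [b (Curl Omega alphah) e]bC [b (Curl Omega w) e]bC !orth// subrr.
- rewrite NE.
  have := @quasi_optimal R _ (L2v Omega) b S_lin bC b_lin b0 (Xh Omega k TT) p ph q e
    Xh2 Xh_lin p2 e2 Xph Xq Hq gal.
  have : 0 <= Num.sqrt (b (p - q) (p - q)) by exact: sqrtr_ge0.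
  rewrite /normv -/b; lra.
Qed.

End Galerkin.

Theorem theorem3p9 (R : realType) (Omega : set (R * R))
    (Omega_dom : polygonal_lipschitz_domain Omega)
    (Omega_sc : simply_connected Omega)
    (T0 : set (marked_triangle R)) (T0_reg : regular_triangulation Omega T0)
    (k : nat) :
  exists2 C : R, 0 < C &
  forall (f : R * R -> R) (phi : R * R -> R * R),
    L2 Omega f -> Hdiv Omega phi -> is_weak_div Omega phi (fun x => - f x) ->
  forall TT : set (marked_triangle R), admissible Omega T0 TT ->
  forall (p : R * R -> R * R) (alpha : R * R -> R)
         (ph : R * R -> R * R) (alphah : R * R -> R),
    mixed_solution Omega (Xspace Omega) (Yspace Omega) phi p alpha ->
    mixed_solution Omega (Xh Omega k TT) (Yh Omega k TT) phi ph alphah ->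
  exists m1 m2 : R,
    [/\ is_min [set normv Omega (p \- qh) | qh in Xh Omega k TT] m1,
        is_min [set normv Omega (Curl Omega (alpha \- betah))
               | betah in Yh Omega k TT] m2 &
        normv Omega (p \- ph) + normv Omega (Curl Omega (alpha \- alphah))
          <= C * (m1 + m2)].
Proof.
exists 2; first exact: ltr0n.
move=> f phi _ _ _ TT [_ reg] p alpha ph alphah.
exact: best_approximation.
Qed.
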